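(* Suppose that Assumptions 1, 2 and 3 (all stated in the context) are satisfied. If $m^\ast\le\widehat m\le m_{\max}$, then $$\mathbb P\big(h(\widehat{\mathcal T}_{\widehat m},\mathcal T^\ast_{m^\ast})\le T\delta_T\big)\to1\quad\text{as }T\to\infty.$$
   Context: **Model.** $(X_t)$ is a sequence of $p$-dimensional random vectors, observed for $t=1,\ldots,T$; $\mathcal X_T=(X_1,\ldots,X_T)$. There are $m^\ast$ true change points, $\mathcal T^\ast_{m^\ast}=\{T^\ast_1<\cdots<T^\ast_{m^\ast}\}$, with the convention $T^\ast_0=1$, $T^\ast_{m^\ast+1}=T+1$, and blocks $\mathcal B^\ast_j=\{T^\ast_{j-1},\ldots,T^\ast_j-1\}$, $1\le j\le m^\ast+1$, partitioning $\{1,\ldots,T\}$. For $t\in\mathcal B^\ast_j$: $\mathbb E[X_t]=0$, $\mathrm{Var}(X_t)=\Sigma^\ast_j$, and $\Theta^\ast_t=\Omega^\ast_j=(\Sigma^\ast_j)^{-1}$ is the true precision matrix. The asymptotic regime is $T\to\infty$; the quantities $p$, $m^\ast$, $T_j^\ast$, $\Omega_j^\ast$, $\lambda_1,\lambda_2$ may depend on $T$. The number $m^\ast$ is assumed bounded by a known conservative upper bound $m_{\max}$, with $m_{\max}\le C\log(T)$ for some $C>0$ large enough. **Estimator (GFDtL).** For tuning parameters $\lambda_1,\lambda_2$, $$\{\widehat\Theta_t\}_{t=1}^T=\arg\min_{\Theta_t\succeq 0,\,1\le t\le T}\Big\{\frac1T\sum_{t=1}^T\big[\mathrm{tr}(\tfrac12\Theta_t^2X_tX_t^\top)-\mathrm{tr}(\Theta_t)\big]+\lambda_1\sum_{t=1}^T\|\Theta_t\|_{1,\mathrm{off}}+\lambda_2\sum_{t=2}^T\|\Theta_t-\Theta_{t-1}\|_F\Big\},$$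 where $\Theta_t$ ranges over symmetric positive semi-definite $p\times p$ matrices, $\|A\|_{1,\mathrm{off}}=\sum_{k\ne l}|A_{kl}|$ and $\|\cdot\|_F$ is the Frobenius norm. For a solution, the estimated change points $\widehat{\mathcal T}_{\widehat m}=\{\widehat T_1<\cdots<\widehat T_{\widehat m}\}$ are the indices $t\in\{2,\ldots,T\}$ with $\widehat\Theta_t\ne\widehat\Theta_{t-1}$, and $\widehat m$ is their number. **Notation.** For sets $A,B$, $h(A,B)=\sup_{b\in B}\inf_{a\in A}|a-b|$. $\mathcal I^\ast_j=T^\ast_j-T^\ast_{j-1}$, $\mathcal I_{\min}=\min_{1\le j\le m^\ast+1}|\mathcal I^\ast_j|$, $\eta_{\min}=\min_{1\le j\le m^\ast}\|\Omega^\ast_{j+1}-\Omega^\ast_j\|_F$, $\eta_{\max}=\max_{1\le j\le m^\ast}\|\Omega^\ast_{j+1}-\Omega^\ast_j\|_F$, $s^\ast_{\max}=\max_{1\le j\le m^\ast+1}\|\Omega^\ast_j\|_F$. With $\mathcal F^0_{-\infty}$ and $\mathcal F^\infty_T$ the $\sigma$-fields generated by $\{X_t:-\infty\le t\le 0\}$ and $\{X_t:T\le t\le\infty\}$, the mixing coefficient is $\alpha(T)=\sup_{A\in\mathcal F^0_{-\infty},B\in\mathcal F^\infty_T}|\mathbb P(A\cap B)-\mathbb P(A)\mathbb P(B)|$. $\lambda_{\min},\lambda_{\max}$ denote smallest and largest eigenvalues. **Assumption 1.** (i) There exists $0<\rho<1$ such that $\alpha(t)\le c_\alpha\rho^t$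 for all $t\in\mathbb Z^+$, with $c_\alpha>0$. (ii) There exist $\gamma,b>0$ such that for all $s>0$ and all $1\le k,l\le p$, $\sup_{t\ge1}\mathbb P(|X_{k,t}X_{l,t}|>s)\le\exp(1-(s/b)^\gamma)$. **Assumption 2.** There exist $\underline\mu,\overline\mu$ with $0<\underline\mu\le\min_{1\le j\le m^\ast+1}\lambda_{\min}(\Sigma^\ast_j)$ and $\max_{1\le j\le m^\ast+1}\lambda_{\max}(\Sigma^\ast_j)\le\overline\mu<\infty$. **Assumption 3.** $(\delta_T)$ is a non-increasing positive sequence converging to zero such that: (i) $T\delta_T\ge c_v\log(pT)^{(2+\gamma)/\gamma}$ for some $c_v>0$; (ii) $m^\ast=O(\log T)$ and $\mathcal I_{\min}/(T\delta_T)\to\infty$ as $T\to\infty$; (iii) $\eta_{\max}=O(1)$, $p\sqrt{\log(pT)/(T\delta_T)}\to0$ and $(\sqrt{T\delta_T}\,\eta_{\min})^{-1}p\,s^\ast_{\max}\sqrt{\log(pT)}\to0$; (iv) $\lambda_2/(\eta_{\min}\delta_T)\to0$ and $\lambda_1Tp/\eta_{\min}\to0$ as $T\to\infty$.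
   Formalization: The mixing coefficient α(n) is taken as a supremum over all time origins r (past up to r, future from r+n), not only origin 0 as written; with origin 0 alone the observed data could be fully dependent and the claim fails. *)

(* Defs.v *)
From HB Require Import structures.
From mathcomp Require Import all_boot all_order all_algebra.
From mathcomp Require Import all_classical all_reals all_analysis.
Import Order.TTheory GRing.Theory Num.Theory.
Import numFieldNormedType.Exports.

Set Implicit Arguments.
Unset Strict Implicit.
Unset Printing Implicit Defensive.

Local Open Scope classical_set_scope.
Local Open Scope ring_scope.

Definition frob (R : realType) (p : nat) (A : 'M[R]_p) : R :=
  Num.sqrt (\sum_(k < p) \sum_(l < p) A k l ^+ 2).

Definition norm1off (R : realType) (p : nat) (A : 'M[R]_p) : R :=
  \sum_(k < p) \sum_(l < p | l != k) `|A k l|.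

Definition psd (R : realType) (p : nat) (A : 'M[R]_p) : Prop :=
  A^T = A /\ forall u : 'cV[R]_p, 0 <= (u^T *m A *m u) 0 0.

(* Meant for symmetric matrices of positive size, whose set of (real)
   eigenvalues is finite and nonempty. *)
Definition lambda_min (R : realType) (p : nat) (A : 'M[R]_p) : R :=
  inf [set a | eigenvalue A a].

Definition lambda_max (R : realType) (p : nat) (A : 'M[R]_p) : R :=
  sup [set a | eigenvalue A a].

(* The values are extended reals: h(A, B) = +oo if A is empty and B is not,
   and h(A, B) = -oo if B is empty. *)
Definition hdist (R : realType) (A B : set nat) : \bar R :=
  ereal_sup [set ereal_inf [set (`|a%:R - b%:R|)%:E | a in A] | b in B].

Definition gfdtl_objective (R : realType) (p T : nat) (lambda1 lambda2 : R)
    (x : nat -> 'cV[R]_p) (Theta : nat -> 'M[R]_p) : R :=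
  T%:R^-1 * (\sum_(1 <= t < T.+1)
      (\tr (2^-1 *: (Theta t *m Theta t *m (x t *m (x t)^T)))
       - \tr (Theta t)))
  + lambda1 * (\sum_(1 <= t < T.+1) norm1off (Theta t))
  + lambda2 * (\sum_(2 <= t < T.+1) frob (Theta t - Theta t.-1)).

(* The minimizer need neither exist nor be unique, so "argmin" is a predicate.
   Only the values of Theta at 1, ..., T matter. *)
Definition is_gfdtl (R : realType) (p T : nat) (lambda1 lambda2 : R)
    (x : nat -> 'cV[R]_p) (Theta : nat -> 'M[R]_p) : Prop :=
  (forall t, (1 <= t <= T)%N -> psd (Theta t)) /\
  (forall Theta' : nat -> 'M[R]_p,
     (forall t, (1 <= t <= T)%N -> psd (Theta' t)) ->
     gfdtl_objective T lambda1 lambda2 x Theta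
       <= gfdtl_objective T lambda1 lambda2 x Theta').

Definition est_cps (R : realType) (p T : nat) (Theta : nat -> 'M[R]_p) :
    seq nat :=
  [seq t <- index_iota 2 T.+1 | Theta t != Theta t.-1].

Definition true_cps (m : nat) (Tstar : nat -> nat) : set nat :=
  [set Tstar j | j in [set j | (1 <= j <= m)%N]].

(* Precision matrix of the j-th block. *)
Definition prec (R : realType) (p : nat) (Sigma : nat -> 'M[R]_p) (j : nat) :
    'M[R]_p := invmx (Sigma j).

(* The minima and maxima below range over finite sets.  If m = 0, eta_min is
   the infimum of the empty set, which is 0; its inverse is then 0 as well, so
   that the limits of assumption3 divided by eta_min put no constraint on the
   sample sizes without change point. *)
Definition I_min (R : realType) (m : nat) (Tstar : nat -> nat) : R :=
  inf [set (Tstar j - Tstar j.-1)%:R | j in [set j | (1 <= j <= m.+1)%N]].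

Definition eta_min (R : realType) (p m : nat) (Sigma : nat -> 'M[R]_p) : R :=
  inf [set frob (prec Sigma j.+1 - prec Sigma j)
      | j in [set j | (1 <= j <= m)%N]].

Definition eta_max (R : realType) (p m : nat) (Sigma : nat -> 'M[R]_p) : R :=
  sup [set frob (prec Sigma j.+1 - prec Sigma j)
      | j in [set j | (1 <= j <= m)%N]].

Definition s_max (R : realType) (p m : nat) (Sigma : nat -> 'M[R]_p) : R :=
  sup [set frob (prec Sigma j) | j in [set j | (1 <= j <= m.+1)%N]].

Section process.
Context (R : realType) (d : measure_display) (Omega : measurableType d)
  (P : probability Omega R) (p : nat) (X : int -> Omega -> 'cV[R]_p).

Definition coord_rv (k : 'I_p) (t : int) : Omega -> R := fun w => X t w k 0.

(* sigma-field generated by {X_t : t in D} *)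
Definition sigma_field (D : set int) : set (set Omega) :=
  <<s [set A | exists t k B,
         [/\ D t, measurable B & A = coord_rv k t @^-1` B] ] >>.

(* The process has change points, hence is not stationary: the coefficient is
   taken uniformly in the time r separating the past from the future. *)
Definition alpha_mix (n : nat) : \bar R :=
  ereal_sup [set y | exists r : int, exists A B : set Omega,
    [/\ sigma_field [set t : int | t <= r] A,
        sigma_field [set t : int | r + n%:Z <= t] B &
        y = `| P (A `&` B) - P A * P B |%E] ].

Definition change_point_model (T m : nat) (Tstar : nat -> nat)
    (Sigma : nat -> 'M[R]_p) : Prop :=
  [/\ (0 < p)%N,
      (forall k t, measurable_fun setT (coord_rv k t)),
      [/\ Tstar 0 = 1, Tstar m.+1 = T.+1
        & forall j, (j <= m)%N -> (Tstar j < Tstar j.+1)%N],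
      (forall j, (1 <= j <= m)%N -> prec Sigma j.+1 != prec Sigma j) &
      (forall j t, (1 <= j <= m.+1)%N -> (Tstar j.-1 <= t < Tstar j)%N ->
         (forall k, 'E_P[coord_rv k t%:Z] = 0)%E /\
         (forall k l,
            covariance P (coord_rv k t%:Z) (coord_rv l t%:Z) = (Sigma j k l)%:E))].

Definition assumption1 (calpha rho gamma b : R) : Prop :=
  (forall t : nat, (0 < t)%N -> (alpha_mix t <= (calpha * rho ^+ t)%:E)%E) /\
  (forall (s : R) (k l : 'I_p), 0 < s ->
     (ereal_sup [set P [set w | (s < `|coord_rv k t w * coord_rv l t w|)%R]
                | t in [set t : int | (1 <= t)%R]]
      <= (expR (1 - (s / b) `^ gamma))%:E)%E).

End process.

Definition assumption2 (R : realType) (p m : nat) (Sigma : nat -> 'M[R]_p)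
    (mu_lo mu_hi : R) : Prop :=
  forall j, (1 <= j <= m.+1)%N ->
    mu_lo <= lambda_min (Sigma j) /\ lambda_max (Sigma j) <= mu_hi.

Record assumption3 (R : realType) (p m : nat -> nat)
    (Tstar : nat -> nat -> nat) (Sigma : forall T : nat, nat -> 'M[R]_(p T))
    (gamma : R) (delta lambda1 lambda2 : nat -> R) : Prop := Assumption3 {
  delta_gt0 : forall T, (0 < T)%N -> 0 < delta T ;
  delta_noninc : forall S T, (0 < S <= T)%N -> delta T <= delta S ;
  delta_cvg0 : delta T @[T --> \oo] --> (0 : R) ;
  a3_i : exists2 cv : R, 0 < cv & forall T, (0 < T)%N ->
    cv * ln ((p T * T)%:R) `^ ((2 + gamma) / gamma) <= T%:R * delta T ;
  a3_ii_m : (fun T => (m T)%:R : R^o) =O_\oo (fun T => ln (T%:R) : R^o) ;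
  a3_ii_I : I_min R (m T) (Tstar T) / (T%:R * delta T) @[T --> \oo] --> +oo ;
  a3_iii_eta : (fun T => eta_max (m T) (@Sigma T) : R^o)
                 =O_\oo (fun=> 1 : R^o) ;
  a3_iii_p : (p T)%:R * Num.sqrt (ln ((p T * T)%:R) / (T%:R * delta T))
               @[T --> \oo] --> (0 : R) ;
  a3_iii_s : (Num.sqrt (T%:R * delta T) * eta_min (m T) (@Sigma T))^-1
               * (p T)%:R * s_max (m T) (@Sigma T)
               * Num.sqrt (ln ((p T * T)%:R)) @[T --> \oo] --> (0 : R) ;
  a3_iv_2 : lambda2 T / (eta_min (m T) (@Sigma T) * delta T)
              @[T --> \oo] --> (0 : R) ;
  a3_iv_1 : lambda1 T * T%:R * (p T)%:R / eta_min (m T) (@Sigma T)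
              @[T --> \oo] --> (0 : R)
}.

(* "S_T holds with probability tending to one", for events S_T that are not
   assumed to be measurable. *)
Definition whp (R : realType) (d : measure_display) (Omega : measurableType d)
    (P : probability Omega R) (S : nat -> set Omega) : Prop :=
  exists E : nat -> set Omega,
    [/\ forall T, measurable (E T), forall T, E T `<=` S T
      & P (E T) @[T --> \oo] --> 1%E].

(* Main.v *)
(** For a true change point [c] put [N = floor (T delta) + 1].  If no estimated
    change point lies within [T delta] of [c], the estimator is a constant [A]
    on [c - N, c + N), and one of the two adjacent precision matrices, [Om], is
    at distance at least [eta_min / 2] from [A].  Comparing the objective at the
    estimator with its value after replacing [A] by [Om] on the window of length
    [N] on that side of [c] gives, with [D = Om - A], [G] the sum over the
    window of [X_t X_t^T - Sigma], and [mu] a lower bound for the eigenvalues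
    of [Sigma],
      [(N mu - |G|) |D|^2 / 2 <= (|Om| |G| + T (lambda1 N p + 2 lambda2)) |D|],
    which is impossible once [|G| / N] is small compared with
    [eta_min / s_max].

    No exponential inequality is needed: geometric mixing and the Weibull tails
    make the covariances of the products [X_k X_l] decay geometrically, so that
    [E |G|^2 = O(p^2 N)].  Markov's inequality for the sum of [|G|^2] over the
    [2 m] windows, with [m = O(log T)], is enough because assumption 3 (iii)
    contains a factor [log (pT)]. *)

Require Import Defs.
From HB Require Import structures.
From mathcomp Require Import all_boot all_order all_algebra.
From mathcomp Require Import all_classical all_reals all_analysis measurable_realfun.
From mathcomp Require Import ring lra zify.
Import Order.TTheory GRing.Theory Num.Theory.
Import numFieldNormedType.Exports.
Local Open Scope classical_set_scope.
Local Open Scope ring_scope.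

Set Implicit Arguments.
Unset Strict Implicit.
Unset Printing Implicit Defensive.

(** * Frobenius norm *)

(** The window inequality has no linear term at the population level: the expected loss
    [tr (B B Sigma) / 2 - tr B] is quadratic and its gradient vanishes at [Om = Sigma^-1], so the
    term linear in [D] sees the data only through [G].

    The obstacle on the probabilistic side is that mixing controls probabilities of events, whereas
    the products [X_k X_l] are unbounded. Each product is replaced by a staircase of mesh [h] and
    height [K h], that is, by a combination of indicators of superlevel sets. At lag [n] the choice
    [h = rho^(n/4)] and [K h] of order [1 / h] makes every error [O(h)]: the staircases contribute
    [(K h)^2 rho^n], of order [h^2], and the truncation is paid for by fourth moments, through which
    the Weibull tails enter. All constants obtained this way depend on [calpha], [rho], [gamma] and
    [b] alone, hence are uniform in [T] and [p]. *)

Lemma sum_cauchy_schwarz (R : realFieldType) (I : finType) (a b : I -> R) :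
  (\sum_i a i * b i) ^+ 2 <= (\sum_i a i ^+ 2) * (\sum_i b i ^+ 2).
Proof.
set A := \sum_i a i ^+ 2; set B := \sum_i b i ^+ 2; set C := \sum_i a i * b i.
have B0 : 0 <= B by apply: sumr_ge0 => i _; exact: sqr_ge0.
(* Multiplying by [B] turns the defect into a sum of squares without division; the degenerate case
   [B = 0], where all [b i] vanish, comes last. *)
have key : 0 <= B * (A * B - C ^+ 2).
  have -> : B * (A * B - C ^+ 2) = \sum_i (B * a i - C * b i) ^+ 2.
    under eq_bigr => i _ do have -> : (B * a i - C * b i) ^+ 2 =
       B ^+ 2 * a i ^+ 2 + (- (2 * B * C) * (a i * b i) + C ^+ 2 * b i ^+ 2) by ring.
    rewrite !big_split /= -!mulr_sumr -/A -/B -/C; ring.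
  by apply: sumr_ge0 => i _; exact: sqr_ge0.
have [B_gt0|] := ltP 0 B; first by rewrite -subr_ge0; rewrite pmulr_rge0 in key.
move=> B_le0; have B_eq0 : B = 0 by apply/le_anti; rewrite B0 B_le0.
have b0 i : b i = 0.
  have := psumr_eq0P (fun i _ => sqr_ge0 (b i)) B_eq0 (erefl : xpredT i).
  by move/eqP; rewrite sqrf_eq0 => /eqP.
by rewrite B_eq0 mulr0 /C big1 ?expr0n // => i _; rewrite b0 mulr0.
Qed.

Section frobenius.
Variables (R : realType) (p : nat).
Implicit Types A B D : 'M[R]_p.

(** The inner product of the Frobenius norm, with pairs as a single index so that
    [sum_cauchy_schwarz] applies directly. *)
Definition mxdot A B : R := \sum_(ij : 'I_p * 'I_p) A ij.1 ij.2 * B ij.1 ij.2.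

Lemma frobE A : frob A = Num.sqrt (mxdot A A).
Proof.
by rewrite /frob /mxdot pair_big.
Qed.

Lemma mxdot_ge0 A : 0 <= mxdot A A.
Proof. by apply: sumr_ge0 => i _; rewrite -expr2 sqr_ge0. Qed.

Lemma frob_ge0 A : 0 <= frob A. Proof. exact: sqrtr_ge0. Qed.

Lemma sqr_frob A : frob A ^+ 2 = mxdot A A.
Proof. by rewrite frobE sqr_sqrtr // mxdot_ge0. Qed.

Lemma ler_frob A (x : R) : 0 <= x -> mxdot A A <= x ^+ 2 -> frob A <= x.
Proof. by move=> x0 h; rewrite -(@ler_pXn2r _ 2) ?nnegrE ?frob_ge0 // sqr_frob. Qed.

Lemma normr_mxdot A B : `|mxdot A B| <= frob A * frob B.
Proof.
rewrite -(@ler_pXn2r _ 2) ?nnegrE ?mulr_ge0 ?frob_ge0 //.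
rewrite real_normK ?num_real // exprMn !sqr_frob /mxdot.
exact: sum_cauchy_schwarz (fun ij => A ij.1 ij.2) (fun ij => B ij.1 ij.2).
Qed.

Lemma mxdotDD A B : mxdot (A + B) (A + B) = mxdot A A + mxdot A B *+ 2 + mxdot B B.
Proof.
rewrite /mxdot -sumrMnl -!big_split /=; apply: eq_bigr => i _; rewrite !mxE; ring.
Qed.

Lemma ler_frobD A B : frob (A + B) <= frob A + frob B.
Proof.
apply: ler_frob; first by rewrite addr_ge0 ?frob_ge0.
rewrite mxdotDD sqrrD !sqr_frob lerD2r lerD2l lerMn2r /=.
exact: le_trans (ler_norm _) (normr_mxdot _ _).
Qed.

Lemma frobZ (c : R) A : frob (c *: A) = `|c| * frob A.
Proof.
rewrite !frobE -sqrtr_sqr -sqrtrM ?sqr_ge0 //; congr Num.sqrt.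
by rewrite /mxdot mulr_sumr; apply: eq_bigr => i _; rewrite !mxE; ring.
Qed.

Lemma frobN A : frob (- A) = frob A.
Proof. by rewrite -scaleN1r frobZ normrN1 mul1r. Qed.

Lemma frob0 : frob (0 : 'M[R]_p) = 0.
Proof. by rewrite -(scale0r 0) frobZ normr0 mul0r. Qed.

Lemma frob_eq0 A : frob A = 0 -> A = 0.
Proof.
move=> h; have := sqr_frob A; rewrite h expr0n /= => /esym.
rewrite /mxdot => /psumr_eq0P h0; apply/matrixP => i j; rewrite mxE.
apply/eqP; rewrite -sqrf_eq0 expr2; apply/eqP.
by apply: (h0 _ (i, j)) => // k _; rewrite -expr2 sqr_ge0.
Qed.

Lemma frob_gt0 A : A != 0 -> 0 < frob A.
Proof.
by move=> A0; rewrite lt0r frob_ge0 andbT; apply: contraNneq A0 => /frob_eq0 ->.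
Qed.

Lemma frob_tr A : frob A^T = frob A.
Proof.
by rewrite /frob exchange_big /=; congr Num.sqrt; apply: eq_bigr => i _;
  apply: eq_bigr => j _; rewrite mxE.
Qed.

(** Cauchy-Schwarz bounds each entry of the product by a row of [A] times a column of [B], and the
    double sum of these bounds factors. *)
Lemma frobM A B : frob (A *m B) <= frob A * frob B.
Proof.
apply: ler_frob; first by rewrite mulr_ge0 ?frob_ge0.
rewrite exprMn !sqr_frob {1}/mxdot.
under eq_bigr do rewrite -expr2 mxE.
apply: (@le_trans _ _ (\sum_(ij : 'I_p * 'I_p)
   (\sum_k A ij.1 k ^+ 2) * (\sum_k B k ij.2 ^+ 2))).
  by apply: ler_sum => ij _; exact: sum_cauchy_schwarz.
rewrite -(pair_big xpredT xpredT (fun i j => (\sum_k A i k ^+ 2) * (\sum_k B k j ^+ 2))) /=.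
rewrite /mxdot; under [X in _ <= X * _]eq_bigr do rewrite -expr2.
under [X in _ <= _ * X]eq_bigr do rewrite -expr2.
rewrite -(pair_big xpredT xpredT (fun i j => A i j ^+ 2)) /=.
rewrite -(pair_big xpredT xpredT (fun i j => B i j ^+ 2)) /=.
rewrite [X in _ <= _ * X]exchange_big /= mulr_suml.
by under eq_bigr do rewrite -mulr_sumr.
Qed.

Lemma mxtrace_mxdot A B : \tr (A *m B) = mxdot A^T B.
Proof.
rewrite /mxtrace /mxdot.
under eq_bigr do rewrite mxE.
rewrite exchange_big pair_big /=; apply: eq_bigr => i _; by rewrite mxE.
Qed.

Lemma normr_mxtrace_mul A B : `|\tr (A *m B)| <= frob A * frob B.
Proof. by rewrite mxtrace_mxdot -(frob_tr A) normr_mxdot. Qed.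

Lemma norm1offD A B : norm1off (A + B) <= norm1off A + norm1off B.
Proof.
rewrite /norm1off -big_split; apply: ler_sum => i _; rewrite -big_split.
by apply: ler_sum => j _; rewrite mxE ler_normD.
Qed.

(** Cauchy-Schwarz against the constant family 1 over the [p ^ 2] entries gives the factor [p]. *)
Lemma norm1off_le_frob A : norm1off A <= p%:R * frob A.
Proof.
apply: (@le_trans _ _ (\sum_(ij : 'I_p * 'I_p) `|A ij.1 ij.2|)).
  rewrite /norm1off -(pair_big xpredT xpredT (fun i j => `|A i j|)) /=.
  apply: ler_sum => i _; rewrite [leRHS](bigID (fun l => l != i)) /= lerDl.
  exact: sumr_ge0.
rewrite -(@ler_pXn2r _ 2) ?nnegrE ?mulr_ge0 ?frob_ge0 ?sumr_ge0 //.
have := sum_cauchy_schwarz (fun=> 1) (fun ij : 'I_p * 'I_p => `|A ij.1 ij.2|).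
under eq_bigr do rewrite mul1r.
move=> h; apply: (le_trans h).
rewrite expr1n sumr_const card_prod card_ord exprMn sqr_frob natrM expr2.
by rewrite /mxdot; under eq_bigr do rewrite real_normK ?num_real // expr2.
Qed.

(** By cyclicity the trace is that of [D *m S *m D], whose diagonal entries are the values of the
    form of [S] at the columns of [D]. *)
Lemma psd_trace_form (S D : 'M[R]_p) (mu : R) : D^T = D ->
  (forall u : 'cV[R]_p, mu * (u^T *m u) 0 0 <= (u^T *m S *m u) 0 0) ->
  mu * frob D ^+ 2 <= \tr (D *m D *m S).
Proof.
move=> symD hS; rewrite mxtrace_mulC mulmxA mxtrace_mulC mulmxA sqr_frob.
have -> : mxdot D D = \tr (D *m D) by rewrite mxtrace_mxdot symD.
rewrite /mxtrace mulr_sumr; apply: ler_sum => i _.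
have formE M : (D *m M *m D) i i = ((col i D)^T *m M *m col i D) 0 0.
  rewrite -!mulmxA !mxE; apply: eq_bigr => j _; rewrite !mxE.
  rewrite -[in D i j]symD mxE.
  by congr (_ * _); apply: eq_bigr => k _; rewrite !mxE.
by rewrite formE -{1}[D]mulmx1 formE mulmx1.
Qed.

End frobenius.

(** * Smallest eigenvalue of a symmetric matrix *)

Section symmetric_spectrum.
Variables (R : realType) (p : nat).
Implicit Types (S B M : 'M[R]_p) (u v : 'cV[R]_p).

Definition sqnorm u : R := (u^T *m u) 0 0.

Lemma sqnormE u : sqnorm u = \sum_i u i 0 ^+ 2.
Proof. by rewrite /sqnorm mxE; apply: eq_bigr => i _; rewrite mxE expr2. Qed.

Lemma sqnorm_ge0 u : 0 <= sqnorm u.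
Proof. by rewrite sqnormE sumr_ge0 // => i _; exact: sqr_ge0. Qed.

Lemma sqnorm_gt0 u : u != 0 -> 0 < sqnorm u.
Proof.
move=> u0; rewrite lt0r sqnorm_ge0 andbT; apply: contraNneq u0.
rewrite sqnormE => /psumr_eq0P h; apply/eqP/matrixP => i j.
by rewrite ord1 mxE; apply/eqP; rewrite -sqrf_eq0 h // => k _; exact: sqr_ge0.
Qed.

Lemma sqnormM M u : sqnorm (M *m u) <= frob M ^+ 2 * sqnorm u.
Proof.
rewrite !sqnormE sqr_frob /mxdot.
rewrite -(pair_big xpredT xpredT (fun i j => M i j * M i j)) /= mulr_suml.
apply: ler_sum => i _; rewrite mxE.
exact: sum_cauchy_schwarz (fun j => M i j) (fun j => u j 0).
Qed.

Lemma normr_form M u : `|(u^T *m M *m u) 0 0| <= frob M * sqnorm u.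
Proof.
rewrite -(@ler_pXn2r _ 2) ?nnegrE ?mulr_ge0 ?frob_ge0 ?sqnorm_ge0 //.
rewrite real_normK ?num_real // -mulmxA mxE.
have := sum_cauchy_schwarz (fun i => u i 0) (fun i => (M *m u) i 0).
rewrite -!sqnormE => h; apply: le_trans (_ : sqnorm u * sqnorm (M *m u) <= _).
  by rewrite (eq_bigr (fun i => u i 0 * (M *m u) i 0)) // => i _; rewrite mxE.
rewrite exprMn expr2 [leRHS]mulrC -mulrA ler_wpM2l ?sqnorm_ge0 //.
by rewrite mulrC -expr2 sqnormM.
Qed.

(* Expand [0 <= q (u - t B u)] for the form [q] of [B] at [t = 1 / (frob B + 1)]
   to get [|B u|^2 <= (frob B + 1) q u]. *)
Lemma psd_unit_coercive B : psd B -> B \in unitmx ->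
  exists2 c, 0 < c & forall u, c * sqnorm u <= (u^T *m B *m u) 0 0.
Proof.
move=> [symB psdB] unitB.
have F0 : 0 < frob B + 1 by rewrite ltr_wpDl ?frob_ge0.
have K0 : 0 < frob (invmx B) ^+ 2 + 1 by rewrite ltr_wpDl ?sqr_ge0.
set F := frob B + 1 in F0; set K := frob (invmx B) ^+ 2 + 1 in K0.
exists (K * F)^-1; first by rewrite invr_gt0 mulr_gt0.
move=> u; rewrite mulrC ler_pdivrMr ?mulr_gt0 //.
have uK : sqnorm u <= K * sqnorm (B *m u).
  rewrite -{1}(mulKmx unitB u); apply: (le_trans (sqnormM _ _)).
  by rewrite ler_wpM2r ?sqnorm_ge0 // lerDl.
apply: (le_trans uK); rewrite mulrCA ler_pM2l // mulrC.
have := psdB (u - F^-1 *: (B *m u)).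
have -> : ((u - F^-1 *: (B *m u))^T *m B *m (u - F^-1 *: (B *m u))) 0 0 =
   (u^T *m B *m u) 0 0 - F^-1 * sqnorm (B *m u) *+ 2
   + F^-1 ^+ 2 * ((B *m u)^T *m B *m (B *m u)) 0 0.
  have -> : (u - F^-1 *: (B *m u))^T = u^T - F^-1 *: (B *m u)^T.
    by apply/matrixP => i j; rewrite !mxE.
  rewrite !mulmxBl !mulmxBr -!scalemxAl -!scalemxAr.
  have E1 : u^T *m B *m (B *m u) = (B *m u)^T *m (B *m u).
    by rewrite trmx_mul symB.
  have E2 : (B *m u)^T *m B *m u = (B *m u)^T *m (B *m u) by rewrite mulmxA.
  rewrite E1 E2 /sqnorm !mxE; ring.
have := normr_form B (B *m u).
set y := ((B *m u)^T *m B *m (B *m u)) 0 0; set z := sqnorm _; set w := (_ *m u) 0 0.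
move=> hy hw; have z0 : 0 <= z by exact: sqnorm_ge0.
have yF : y <= F * z.
  by apply: le_trans (le_trans (ler_norm _) hy) _; rewrite ler_wpM2r // lerDl.
have : 0 <= w - F^-1 * z *+ 2 + F^-1 ^+ 2 * (F * z).
  by apply: (le_trans hw); rewrite lerD2l ler_wpM2l // sqr_ge0.
have -> : w - F^-1 * z *+ 2 + F^-1 ^+ 2 * (F * z) = w - F^-1 * z.
  by field; rewrite gt_eqF.
by rewrite subr_ge0 ler_pdivrMl.
Qed.

Lemma not_eigenvalue_unit S a : ~~ eigenvalue S a -> S - a%:M \in unitmx.
Proof. by rewrite /eigenvalue /eigenspace negbK kermx_eq0 row_free_unit. Qed.

Lemma lambda_min_le S mu a : 0 < mu -> mu <= lambda_min S ->
  eigenvalue S a -> mu <= a.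
Proof.
move=> mu0 hmu ea; apply: (le_trans hmu).
(* [inf] takes the default value 0 on a set without infimum, which [0 < mu] rules out. *)
have [[_ lbS]|/inf_out h] := pselect (has_inf [set a | eigenvalue S a]).
  exact: ge_inf.
by move: hmu; rewrite /lambda_min h leNgt mu0.
Qed.

(** A substitute for diagonalization: let [a] be the largest number with [S - a] positive
    semi-definite. If [a < mu], then [a] is not an eigenvalue, so [S - a] is invertible, hence
    coercive by [psd_unit_coercive], and [a] could be increased. *)
Lemma lambda_min_form S mu : S^T = S -> 0 < mu -> mu <= lambda_min S ->
  forall u, mu * sqnorm u <= (u^T *m S *m u) 0 0.
Proof.
move=> symS mu0 hmu.
pose A := [set a : R | forall u, a * sqnorm u <= (u^T *m S *m u) 0 0].
suff : exists2 a, A a & mu <= a.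
  move=> [a Aa mua] u; apply: le_trans (Aa u).
  by rewrite ler_wpM2r ?sqnorm_ge0.
(* In dimension 0 every number is admissible and the supremum makes no sense, so a nonzero vector is
   split off first. *)
have [[u0 u0_neq0]|all0] := pselect (exists u : 'cV[R]_p, u != 0); last first.
  exists mu => // u; have -> : u = 0.
    by apply/eqP; apply: contrapT => /negP h; apply: all0; exists u.
  by rewrite /sqnorm !mulmx0 mxE mulr0.
have supA : has_sup A.
  split.
    exists (- frob S) => u.
    by have := normr_form S u; rewrite ler_norml => /andP[]; rewrite mulNr.
  exists ((u0^T *m S *m u0) 0 0 / sqnorm u0) => a Aa.
  by rewrite ler_pdivlMr ?sqnorm_gt0.
have AsupA : A (sup A).
  move=> u; have [->|u_neq0] := eqVneq u 0.
    by rewrite /sqnorm !mulmx0 mxE mulr0.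
  rewrite -ler_pdivlMr ?sqnorm_gt0 //; apply: ge_sup; first by case: supA.
  by move=> a Aa; rewrite ler_pdivlMr ?sqnorm_gt0.
exists (sup A) => //; rewrite leNgt; apply/negP => lt_mu.
have formB a u : (u^T *m (S - a%:M) *m u) 0 0 =
    (u^T *m S *m u) 0 0 - a * sqnorm u.
  by rewrite mulmxBr mulmxBl mul_mx_scalar -scalemxAl mxE; congr (_ + _); rewrite 2!mxE.
have unitB : S - (sup A)%:M \in unitmx.
  apply: not_eigenvalue_unit; apply/negP => /(lambda_min_le mu0 hmu).
  by rewrite leNgt lt_mu.
have psdB : psd (S - (sup A)%:M).
  split; first by rewrite linearB /= symS tr_scalar_mx.
  by move=> u; rewrite formB subr_ge0.
have [c c0 hc] := psd_unit_coercive psdB unitB.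
have : A (sup A + c).
  by move=> u; have := hc u; rewrite formB lerBrDl -mulrDl.
move=> /(ub_le_sup supA.2); by rewrite gerDl leNgt c0.
Qed.

Lemma lambda_min_unit S mu : 0 < mu -> mu <= lambda_min S -> S \in unitmx.
Proof.
move=> mu0 hmu; rewrite -[S]subr0 -(raddf0 (@scalar_mx R p)).
apply: not_eigenvalue_unit; apply/negP => /(lambda_min_le mu0 hmu).
by rewrite leNgt mu0.
Qed.

Lemma psd_invmx S : S \in unitmx -> psd S -> psd (invmx S).
Proof.
move=> unitS [symS psdS]; have symI : (invmx S)^T = invmx S.
  by rewrite trmx_inv symS.
split=> // u; have := psdS (invmx S *m u).
by rewrite trmx_mul symI -!mulmxA mulKVmx.
Qed.

End symmetric_spectrum.

(** * Comparison of objectives on a window *)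

Lemma sum_window (R : realFieldType) (T a N : nat) (F : nat -> R) :
  (1 <= a)%N -> (a + N <= T.+1)%N ->
  (forall t, ~~ (a <= t < a + N)%N -> F t = 0) ->
  \sum_(1 <= t < T.+1) F t = \sum_(a <= t < a + N) F t.
Proof.
move=> a1 aNT F0.
rewrite (@big_cat_nat _ _ _ a) //=; last by rewrite (leq_trans _ aNT) ?leq_addr.
rewrite (@big_cat_nat _ _ _ (a + N) a T.+1) ?leq_addr //=.
rewrite big1_seq ?add0r; last first.
  move=> t; rewrite mem_index_iota => /andP[_ /andP[_ ta]].
  by rewrite F0 // negb_and -ltnNge ta.
rewrite [X in _ + X]big1_seq ?addr0 // => t.
rewrite mem_index_iota => /andP[_ /andP[ta _]].
by rewrite F0 // negb_and -leqNgt ta orbT.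
Qed.

(** Only an inequality, because an end of the window may fall outside the range of the total
    variation sum. *)
Lemma sum_indicator_le1 (R : realFieldType) (m n k : nat) :
  \sum_(m <= t < n) ((t == k)%:R : R) <= 1.
Proof.
under eq_bigr do rewrite mulrb; rewrite -big_mkcond big_nat1_eq.
by case: ifP.
Qed.

(** Used for the indicator of the window at two consecutive times, which can differ only at the two
    ends. *)
Lemma ler_dist_bool (R : realFieldType) (b1 b2 b3 b4 : bool) :
  [|| b1 == b2, b3 | b4] -> `|b1%:R - b2%:R| <= b3%:R + b4%:R :> R.
Proof.
case: b1 b2 b3 b4 => [] [] [] [] //= _.
all: rewrite ?(subrr, subr0, sub0r, normrN, normr0, normr1); lra.
Qed.

Section window_comparison.
Variables (R : realType) (p : nat).
Implicit Types (A B D S G : 'M[R]_p).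

Definition loss (S B : 'M[R]_p) : R := \tr (2^-1 *: (B *m B *m S)) - \tr B.

(** Expand around [Om]: since [Sig *m Om = 1], the linear term [tr (Om D Sig)] cancels against
    [tr D], and what is left is linear in the noise [S - Sig] or quadratic in [D]. *)
Lemma lossB S Sig Om A : S^T = S -> Om^T = Om -> A^T = A -> Sig *m Om = 1%:M ->
  loss S Om - loss S A =
  \tr (Om *m (Om - A) *m (S - Sig))
  - 2^-1 * \tr ((Om - A) *m (Om - A) *m (S - Sig))
  - 2^-1 * \tr ((Om - A) *m (Om - A) *m Sig).
Proof.
move=> symS symO symA SO; rewrite /loss; set D := Om - A.
have symD : D^T = D by rewrite /D linearB /= symO symA.
have AE : A = Om - D by rewrite /D opprB addrC subrK.
clearbody D; rewrite {}AE.
have trO : \tr (Om *m D *m Sig) = \tr D.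
  by rewrite mxtrace_mulC mulmxA SO mul1mx.
have trD : \tr (D *m Om *m S) = \tr (Om *m D *m S).
  by rewrite -mxtrace_tr !trmx_mul symS symO symD mxtrace_mulC.
have trB (B C : 'M[R]_p) : \tr (B - C) = \tr B - \tr C by exact: raddfB.
rewrite !mulmxBr !mulmxBl !mxtraceZ !trB trO trD.
by field.
Qed.

Lemma gfdtl_window_bound (T a N : nat) (l1 l2 mu : R) (x : nat -> 'cV[R]_p)
    (Th : nat -> 'M[R]_p) (Om Sig A : 'M[R]_p) :
  let G := \sum_(a <= t < a + N) (x t *m (x t)^T - Sig) in
  let D := Om - A in
  is_gfdtl T l1 l2 x Th -> (0 < N)%N -> (1 <= a)%N -> (a + N <= T.+1)%N ->
  (forall t, (a <= t < a + N)%N -> Th t = A) ->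
  psd Om -> Sig *m Om = 1%:M ->
  (forall u : 'cV[R]_p, mu * sqnorm u <= (u^T *m Sig *m u) 0 0) ->
  0 <= l1 -> 0 <= l2 ->
  2^-1 * (N%:R * mu - frob G) * frob D ^+ 2 <=
  (frob Om * frob G + T%:R * (l1 * N%:R * p%:R + l2 * 2)) * frob D.
Proof.
move=> G D [psdTh minTh] N0 a1 aNT ThA psdO SO formS l10 l20.
have T0 : (0 < T)%N.
  by rewrite -ltnS (leq_trans _ aNT) // -addn1 leq_add.
have psdA : psd A.
  have <- : Th a = A by apply: ThA; lia.
  by apply: psdTh; lia.
pose W t := (a <= t < a + N)%N.
pose c t : R := (W t)%:R.
(* The competitor equals [Om] on the window and [Th] elsewhere, hence is feasible; its additive form
   lets the penalties be compared by the triangle inequality. *)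
pose Th' t := Th t + c t *: D.
have Th'E t : Th' t = if W t then Om else Th t.
  rewrite /Th' /c; case: ifPn => [Wt|_]; last by rewrite scale0r addr0.
  by rewrite scale1r (ThA _ Wt) /D addrC subrK.
have /minTh : forall t, (1 <= t <= T)%N -> psd (Th' t).
  by move=> t ht; rewrite Th'E; case: ifP => // _; exact: psdTh.
rewrite /gfdtl_objective.
have loss_diff : \sum_(1 <= t < T.+1)
      (\tr (2^-1 *: (Th' t *m Th' t *m (x t *m (x t)^T))) - \tr (Th' t)) =
    \sum_(1 <= t < T.+1)
      (\tr (2^-1 *: (Th t *m Th t *m (x t *m (x t)^T))) - \tr (Th t)) +
    (\tr (Om *m D *m G) - 2^-1 * \tr (D *m D *m G)
     - 2^-1 * (N%:R * \tr (D *m D *m Sig))).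
  apply/eqP; rewrite addrC -subr_eq -sumrB; apply/eqP.
  rewrite (sum_window a1 aNT); last first.
    by move=> t Wt; rewrite Th'E /W (negbTE Wt) subrr.
  have -> : \tr (Om *m D *m G) - 2^-1 * \tr (D *m D *m G)
     - 2^-1 * (N%:R * \tr (D *m D *m Sig)) =
     \sum_(a <= t < a + N) (\tr (Om *m D *m (x t *m (x t)^T - Sig))
       - 2^-1 * \tr (D *m D *m (x t *m (x t)^T - Sig))
       - 2^-1 * \tr (D *m D *m Sig)).
    have trM B : \tr (B *m G) = \sum_(a <= t < a + N)
        \tr (B *m (x t *m (x t)^T - Sig)) by rewrite mulmx_sumr raddf_sum.
    by rewrite !sumrB -!mulr_sumr sumr_const_nat addKn !trM mulr_natl mulrnAr.
  rewrite big_nat [RHS]big_nat; apply: eq_bigr => t Wt.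
  rewrite Th'E /W Wt (ThA _ Wt) -/(loss _ Om) -/(loss _ A).
  apply: lossB => //; [|by case: psdO|by case: psdA].
  by rewrite trmx_mul trmxK.
have off_diff : \sum_(1 <= t < T.+1) norm1off (Th' t) <=
    \sum_(1 <= t < T.+1) norm1off (Th t) + N%:R * (p%:R * frob D).
  have -> : N%:R * (p%:R * frob D) =
      \sum_(1 <= t < T.+1) (c t * (p%:R * frob D)).
    rewrite -mulr_suml; congr (_ * _); rewrite (sum_window a1 aNT); last first.
      by move=> t Wt; rewrite /c /W (negbTE Wt).
    rewrite big_nat (eq_bigr (fun=> 1)); last by move=> t Wt; rewrite /c /W Wt.
    by rewrite -big_nat sumr_const_nat addKn.
  rewrite -big_split; apply: ler_sum => t _ /=.
  apply: (le_trans (norm1offD _ _)); rewrite lerD2l.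
  rewrite /c; case: (W t); first by rewrite scale1r mul1r norm1off_le_frob.
  by rewrite scale0r mul0r (le_trans (norm1off_le_frob _)) // frob0 mulr0.
(* The increments of [Th'] and [Th] differ only where the window opens or closes, each time by at
   most [frob D]. *)
have tv_diff : \sum_(2 <= t < T.+1) frob (Th' t - Th' t.-1) <=
    \sum_(2 <= t < T.+1) frob (Th t - Th t.-1) + 2 * frob D.
  apply: (@le_trans _ _ (\sum_(2 <= t < T.+1) frob (Th t - Th t.-1) +
     \sum_(2 <= t < T.+1) (((t == a)%:R + (t == a + N)%:R) * frob D))).
    rewrite -big_split; apply: ler_sum_nat => t /andP[t2 _] /=.
    have -> : Th' t - Th' t.-1 = (Th t - Th t.-1) + (c t - c t.-1) *: D.
      by rewrite /Th' scalerBl opprD addrACA.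
    apply: (le_trans (ler_frobD _ _)); rewrite lerD2l frobZ ler_wpM2r ?frob_ge0 //.
    have : [|| W t == W t.-1, t == a | t == (a + N)%N] by rewrite /W; lia.
    exact: ler_dist_bool.
  rewrite -mulr_suml lerD2l ler_wpM2r ?frob_ge0 // big_split /=.
  by rewrite (_ : 2 = 1 + 1) // lerD // sum_indicator_le1.
move=> h.
have formD : mu * frob D ^+ 2 <= \tr (D *m D *m Sig).
  apply: psd_trace_form => //.
  by rewrite /D linearB /= (proj1 psdO) (proj1 psdA).
have boundOD : `|\tr (Om *m D *m G)| <= frob Om * frob D * frob G.
  apply: (le_trans (normr_mxtrace_mul _ _)); rewrite ler_wpM2r ?frob_ge0 //.
  exact: frobM.
have boundDD : `|\tr (D *m D *m G)| <= frob D * frob D * frob G.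
  apply: (le_trans (normr_mxtrace_mul _ _)); rewrite ler_wpM2r ?frob_ge0 //.
  exact: frobM.
have T0' : (0 : R) < T%:R by rewrite ltr0n.
have TV : T%:R * T%:R^-1 = 1 :> R by rewrite mulfV ?gt_eqF.
have N0' : (0 : R) <= N%:R by rewrite ler0n.
have := ler_wpM2l l10 off_diff; have := ler_wpM2l l20 tv_diff.
move: h; rewrite loss_diff.
move: boundOD boundDD; rewrite !ler_norml => /andP[_ hO] /andP[hD _].
have := ler_wpM2l N0' formD.
set X := \sum_(_ <= t < _) _; set Y := \sum_(_ <= t < _) norm1off _.
set Z := \sum_(_ <= t < _) frob _; set Y' := \sum_(_ <= t < _) norm1off _.
set Z' := \sum_(_ <= t < _) frob _.
move: hO hD; set u := \tr _; set v := \tr _; set w := \tr _.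
move=> hO hD hN h hZ hY.
(* Minimality combined with the three differences: the loss change plus the largest possible penalty
   change is nonnegative. *)
have : 0 <= T%:R^-1 * (u - 2^-1 * v - 2^-1 * (N%:R * w))
     + l1 * (N%:R * (p%:R * frob D)) + l2 * (2 * frob D) by lra.
move=> /(ler_wpM2l (ltW T0')); rewrite mulr0 !mulrDr !(mulrA T%:R) TV mul1r.
lra.
Qed.
End window_comparison.

(** * Localization of a single change point *)

Section localization.
Variables (R : realType) (p : nat).

Definition scatter (x : nat -> 'cV[R]_p) (Sig : 'M[R]_p) (a N : nat) : 'M[R]_p :=
  \sum_(a <= t < a + N) (x t *m (x t)^T - Sig).

(** Budget of constants: the noise and the [lambda1] term take [N mu eta / 64] each and the
    [lambda2] term twice that, in total [N mu eta / 16]. The curvature keeps at least [N mu / 4], so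
    [frob D <= eta / 4]. *)
Lemma gfdtl_window_close (T a N : nat) (l1 l2 mu s eta dl : R)
    (x : nat -> 'cV[R]_p) (Th : nat -> 'M[R]_p) (Sig A : 'M[R]_p) :
  is_gfdtl T l1 l2 x Th -> (0 < N)%N -> (1 <= a)%N -> (a + N <= T.+1)%N ->
  (forall t, (a <= t < a + N)%N -> Th t = A) ->
  Sig^T = Sig -> 0 < mu -> mu <= lambda_min Sig -> 0 <= l1 -> 0 <= l2 ->
  frob (invmx Sig) <= s -> 0 < eta -> T%:R * dl <= N%:R ->
  frob (scatter x Sig a N) * 2 <= N%:R * mu ->
  s * frob (scatter x Sig a N) * 64 <= N%:R * mu * eta ->
  l1 * T%:R * p%:R * 64 <= mu * eta -> l2 * 64 <= dl * mu * eta ->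
  frob (invmx Sig - A) * 4 <= eta.
Proof.
move=> est N0 a1 aNT ThA symS mu0 hmu l10 l20 sO eta0 TdN G1 G2 h1 h2.
have unitS := lambda_min_unit mu0 hmu.
have formS := lambda_min_form symS mu0 hmu.
have psdO : psd (invmx Sig).
  apply: psd_invmx => //; split=> // u; apply: le_trans (formS u).
  by rewrite mulr_ge0 ?sqnorm_ge0 // ltW.
have := gfdtl_window_bound est N0 a1 aNT ThA psdO (mulmxV unitS) formS l10 l20.
rewrite -/(scatter x Sig a N).
have := frob_ge0 (invmx Sig - A); set D := frob (_ - A).
have := frob_ge0 (scatter x Sig a N); move: G1 G2; set G := frob (scatter _ _ _ _).
move=> G1 G2 G0 D0 h; rewrite leNgt; apply/negP => D_gt.
have D_gt0 : 0 < D by lra.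
have T0 : (0 : R) <= T%:R by rewrite ler0n.
have N0' : (0 : R) < N%:R by rewrite ltr0n.
have OG : frob (invmx Sig) * G <= s * G by rewrite ler_wpM2r.
have h1' := ler_wpM2l (ltW N0') h1.
have h2' := ler_wpM2l T0 h2.
have h3' : (T%:R * dl) * (mu * eta) <= N%:R * (mu * eta).
  by rewrite ler_wpM2r // mulr_ge0 // ltW.
have upper : (frob (invmx Sig) * G + T%:R * (l1 * N%:R * p%:R + l2 * 2)) <=
    N%:R * mu * eta / 16 by lra.
have := le_trans h (ler_wpM2r D0 upper); rewrite expr2 mulrA ler_pM2r //.
have lower : N%:R * mu / 4 <= 2^-1 * (N%:R * mu - G) by lra.
move=> h4; have := le_trans (ler_wpM2r D0 lower) h4.
rewrite mulrAC -[X in _ <= X]mulrA -!(mulrA (N%:R * mu)) ler_pM2l ?mulr_gt0 //; lra.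
Qed.

(** A time strictly between [c - N] and [c + N] is at distance at most [N - 1 <= T dl] from [c], so
    it is not an estimated change point. A jump at [c - N] itself is harmless. *)
Lemma window_constant (T N c : nat) (dl : R) (Th : nat -> 'M[R]_p) :
  (N < c)%N -> (c + N <= T.+1)%N -> N%:R <= T%:R * dl + 1 ->
  (forall t, t \in est_cps T Th -> T%:R * dl < `|t%:R - c%:R|) ->
  forall t, (c - N <= t < c + N)%N -> Th t = Th c.
Proof.
move=> Nc cNT Ndl far t ht.
have step u : (c - N < u < c + N)%N -> Th u = Th u.-1.
  move=> hu; apply/eqP; apply: contraT => neq.
  have /far : u \in est_cps T Th.
    by rewrite mem_filter neq mem_index_iota /=; lia.
  rewrite ltNge => /negP[]; rewrite -[_ <= _](lerD2r 1) (le_trans _ Ndl) //.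
  have [uc|cu] := leqP c u.
    rewrite -natrB // normr_nat natr1 ler_nat; lia.
  rewrite distrC -natrB 1?ltnW // normr_nat natr1 ler_nat; lia.
have up k : (k < N)%N -> Th (c + k)%N = Th c.
  elim: k => [|k IH] kN; first by rewrite addn0.
  rewrite addnS step /=; last lia.
  by apply: IH; lia.
have down k : (k <= N)%N -> Th (c - k)%N = Th c.
  elim: k => [|k IH] kN; first by rewrite subn0.
  rewrite subnS -step; last lia.
  by apply: IH; lia.
have [ct|tc] := leqP c t.
  by rewrite -(subnKC ct) up //; lia.
by rewrite -(subKn (ltnW tc)) down //; lia.
Qed.

(** Otherwise the same matrix [Th c] would be within [eta / 4] of both precision matrices, whose
    distance is at least [eta]. *)
Lemma change_point_located (T N c : nat) (l1 l2 mu s eta dl : R)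
    (x : nat -> 'cV[R]_p) (Th : nat -> 'M[R]_p) (Sl Sr : 'M[R]_p) :
  is_gfdtl T l1 l2 x Th -> (0 < N)%N -> (N < c)%N -> (c + N <= T.+1)%N ->
  T%:R * dl <= N%:R <= T%:R * dl + 1 ->
  Sl^T = Sl -> Sr^T = Sr ->
  0 < mu -> mu <= lambda_min Sl -> mu <= lambda_min Sr -> 0 <= l1 -> 0 <= l2 ->
  frob (invmx Sl) <= s -> frob (invmx Sr) <= s ->
  0 < eta -> eta <= frob (invmx Sr - invmx Sl) ->
  (forall G, G = frob (scatter x Sl (c - N) N) \/ G = frob (scatter x Sr c N) ->
     G * 2 <= N%:R * mu /\ s * G * 64 <= N%:R * mu * eta) ->
  l1 * T%:R * p%:R * 64 <= mu * eta -> l2 * 64 <= dl * mu * eta ->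
  exists2 t, t \in est_cps T Th & `|t%:R - c%:R| <= T%:R * dl.
Proof.
move=> est N0 Nc cNT.
have cN1 : (1 <= c - N)%N by rewrite subn_gt0.
have cNK : (c - N + N = c)%N by rewrite subnK // ltnW.
have cNT' : (c - N + N <= T.+1)%N by rewrite cNK (leq_trans _ cNT) ?leq_addr.
have c1 : (1 <= c)%N by rewrite (leq_trans _ Nc).
have inL t : (c - N <= t < c - N + N)%N -> (c - N <= t < c + N)%N.
  by rewrite cNK => /andP[-> tc]; rewrite (leq_trans tc) ?leq_addr.
have inR t : (c <= t < c + N)%N -> (c - N <= t < c + N)%N.
  by move=> /andP[ct ->]; rewrite (leq_trans _ ct) ?leq_subr.
move=> /andP[Nlo Nhi] symL symR mu0 muL muR l10 l20 sL sR eta0 hjump.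
move=> hG h1 h2; apply: contrapT => none.
have const := @window_constant T N c dl Th Nc cNT Nhi.
have {}const t : (c - N <= t < c + N)%N -> Th t = Th c.
  apply: const => u hu; rewrite ltNge; apply/negP => hle; apply: none.
  by exists u.
have [GL1 GL2] := hG _ (or_introl erefl).
have [GR1 GR2] := hG _ (or_intror erefl).
have dL : frob (invmx Sl - Th c) * 4 <= eta.
  apply: (gfdtl_window_close est N0 cN1 cNT' _ symL mu0 muL l10 l20 sL eta0 Nlo GL1 GL2 h1 h2).
  by move=> t /inL; exact: const.
have dR : frob (invmx Sr - Th c) * 4 <= eta.
  apply: (gfdtl_window_close est N0 c1 cNT _ symR mu0 muR l10 l20 sR eta0 Nlo GR1 GR2 h1 h2).
  by move=> t /inR; exact: const.
have : frob (invmx Sr - invmx Sl) <= frob (invmx Sr - Th c) + frob (invmx Sl - Th c).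
  rewrite -[X in _ <= _ + X]frobN opprB (le_trans _ (ler_frobD _ _)) //.
  by rewrite addrA subrK.
lra.
Qed.

End localization.

(** * Covariances of square-integrable functions *)

Section second_moments.
Context d (T : measurableType d) (R : realType) (P : probability T R).
Implicit Types f g u v : T -> R.

Local Notation L1 f := (P.-integrable setT (EFin \o f)).
Local Notation Ex f := (Rintegral P setT f).

Definition sqint f :=
  measurable_fun setT f /\ L1 (fun w => f w ^+ 2).

Lemma integrable_dominated f g : measurable_fun setT f -> L1 g ->
  (forall w, `|f w| <= g w) -> L1 f.
Proof.
move=> mf ig fg; apply: (le_integrable _ _ _ ig) => //; first exact/measurable_EFinP.
by move=> w _; rewrite /= lee_fin (le_trans (fg w)) // ler_norm.
Qed.

Lemma integrable_const (c : R) : L1 (fun=> c).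
Proof. exact: finite_measure_integrable_cst. Qed.

Lemma integrable_add f g : L1 f -> L1 g -> L1 (fun w => f w + g w).
Proof. by move=> fi gi; exact: (integrableD measurableT fi gi). Qed.

Lemma integrable_scale (c : R) f : L1 f -> L1 (fun w => c * f w).
Proof. by move=> fi; exact: (integrableZl measurableT c fi). Qed.

Lemma integrable_mfun f : L1 f -> measurable_fun setT f.
Proof. by move=> /measurable_int /measurable_EFinP. Qed.

Lemma Rintegral_le f g : L1 f -> L1 g -> (forall w, f w <= g w) -> Ex f <= Ex g.
Proof. by move=> fi gi fg; apply: le_Rintegral. Qed.

Lemma Rintegral_prob_cst (c : R) : Ex (fun=> c) = c.
Proof. by rewrite Rintegral_cst //= probability_setT mulr1. Qed.

Lemma sqint_mul f g : sqint f -> sqint g -> L1 (fun w => f w * g w).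
Proof.
move=> [mf f2] [mg g2].
apply: (integrable_dominated _ (integrable_add f2 g2)).
  exact: measurable_funM.
move=> w /=; have := sqr_ge0 (`|f w| - `|g w|); rewrite normrM.
have := normr_ge0 (f w); have := normr_ge0 (g w).
rewrite -(real_normK (num_real (f w))) -(real_normK (num_real (g w))); nra.
Qed.

Lemma sqint_cst (c : R) : sqint (fun=> c).
Proof. by split; [exact: measurable_cst|exact: integrable_const]. Qed.

Lemma sqint_L1 f : sqint f -> L1 f.
Proof.
move=> sf; have := sqint_mul (sqint_cst 1) sf.
by congr (integrable P setT (EFin \o _)); apply/funext => w; rewrite mul1r.
Qed.

Lemma sqint_le f g : measurable_fun setT f -> L1 g ->
  (forall w, f w ^+ 2 <= g w) -> sqint f.
Proof.
move=> mf gi fg; split=> //; apply: (integrable_dominated _ gi).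
  exact: measurable_funX.
by move=> w; rewrite ger0_norm ?sqr_ge0.
Qed.

Lemma sqintZ (c : R) f : sqint f -> sqint (fun w => c * f w).
Proof.
move=> [mf f2]; apply: (sqint_le _ (integrable_scale (c ^+ 2) f2)).
  by apply: measurable_funM.
by move=> w; rewrite exprMn.
Qed.

Lemma sqintD f g : sqint f -> sqint g -> sqint (fun w => f w + g w).
Proof.
move=> [mf f2] [mg g2].
apply: (sqint_le _ (integrable_scale 2 (integrable_add f2 g2))).
  exact: measurable_funD.
move=> w; have := sqr_ge0 (f w - g w); nra.
Qed.

Lemma sqintB f g : sqint f -> sqint g -> sqint (fun w => f w - g w).
Proof.
move=> sf sg; have := sqintD sf (sqintZ (-1) sg).
by congr sqint; apply/funext => w; rewrite mulN1r.
Qed.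

Lemma sqint_sum (I : Type) (r : seq I) (F : I -> T -> R) :
  (forall i, sqint (F i)) -> sqint (fun w => \sum_(i <- r) F i w).
Proof.
move=> sF; elim: r => [|i r IH].
  by under eq_fun do rewrite big_nil; exact: sqint_cst.
by under eq_fun do rewrite big_cons; exact: sqintD.
Qed.

Lemma bool_indicE (A : T -> bool) :
  (fun w => (A w)%:R) = \1_[set w | A w] :> (T -> R).
Proof.
apply/funext => w; rewrite indicE; congr (_%:R); congr nat_of_bool.
by apply/idP/idP; rewrite inE.
Qed.

Lemma sqint_bool (A : T -> bool) : measurable [set w | A w] ->
  sqint (fun w => (A w)%:R).
Proof.
move=> mA.
rewrite bool_indicE.
apply: (sqint_le _ (integrable_const 1)) => [|w]; first exact: measurable_indic.
by rewrite indicE; case: (_ \in _); rewrite ?expr1n ?expr0n.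
Qed.

Lemma integral_bool (A : T -> bool) : measurable [set w | A w] ->
  (\int[P]_w ((A w)%:R)%:E = P [set w | A w])%E.
Proof.
move=> mA; rewrite -[X in _ = P X]setIT -integral_indic //.
by rewrite -bool_indicE.
Qed.

Lemma Rintegral_bool (A : T -> bool) : measurable [set w | A w] ->
  Ex (fun w => (A w)%:R) = fine (P [set w | A w]).
Proof. by move=> mA; rewrite /Rintegral integral_bool. Qed.

Lemma sqr_le_1Dpow4 (y : R) : y ^+ 2 <= 1 + y ^+ 4.
Proof.
rewrite -[4%N]/(2 * 2)%N exprM; set z := y ^+ 2.
have z0 : 0 <= z by exact: sqr_ge0.
have := sqr_ge0 (z - 1); nra.
Qed.

Lemma pow4_sqint f : measurable_fun setT f -> L1 (fun w => f w ^+ 4) ->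
  sqint f /\ Ex (fun w => f w ^+ 2) <= 1 + Ex (fun w => f w ^+ 4).
Proof.
move=> mf f4; have i1 := integrable_add (integrable_const 1) f4.
have le1 w : f w ^+ 2 <= 1 + f w ^+ 4 by exact: sqr_le_1Dpow4.
have sf : sqint f by exact: sqint_le i1 le1.
split=> //; apply: (le_trans (Rintegral_le (proj2 sf) i1 le1)).
by rewrite (RintegralD measurableT (integrable_const 1) f4) Rintegral_prob_cst.
Qed.

Definition cov f g := Ex (fun w => f w * g w) - Ex f * Ex g.

Lemma covC f g : cov f g = cov g f.
Proof.
rewrite /cov [X in _ - X]mulrC; congr (_ - _).
by apply: eq_Rintegral => w _; rewrite mulrC.
Qed.

Lemma covDl f g u : sqint f -> sqint g -> sqint u ->
  cov (fun w => f w + g w) u = cov f u + cov g u.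
Proof.
move=> sf sg su; rewrite /cov (RintegralD measurableT (sqint_L1 sf) (sqint_L1 sg)).
under eq_Rintegral do rewrite mulrDl.
rewrite (RintegralD measurableT (sqint_mul sf su) (sqint_mul sg su)); ring.
Qed.

Lemma covZl (c : R) f u : sqint f -> sqint u ->
  cov (fun w => c * f w) u = c * cov f u.
Proof.
move=> sf su; rewrite /cov (RintegralZl _ measurableT (sqint_L1 sf)).
under eq_Rintegral do rewrite -mulrA.
rewrite (RintegralZl _ measurableT (sqint_mul sf su)); ring.
Qed.

Lemma covBl f g u : sqint f -> sqint g -> sqint u ->
  cov (fun w => f w - g w) u = cov f u - cov g u.
Proof.
move=> sf sg su; have := covDl sf (sqintZ (-1) sg) su.
rewrite covZl // mulN1r => <-.
by congr cov; apply/funext => w; rewrite mulN1r.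
Qed.

Lemma sqr_Rintegral_le f : sqint f -> Ex f ^+ 2 <= Ex (fun w => f w ^+ 2).
Proof.
move=> sf; rewrite -subr_ge0.
have -> : Ex (fun w => f w ^+ 2) - Ex f ^+ 2 = Ex (fun w => (f w - Ex f) ^+ 2).
  have -> : Ex (fun w => (f w - Ex f) ^+ 2) =
      Ex (fun w => f w ^+ 2 + ((- 2 * Ex f) * f w + Ex f ^+ 2)).
    by apply: eq_Rintegral => w _; ring.
  have i1 := integrable_scale (- 2 * Ex f) (sqint_L1 sf).
  have i2 := integrable_const (Ex f ^+ 2).
  rewrite (RintegralD measurableT (proj2 sf) (integrable_add i1 i2)).
  rewrite (RintegralD measurableT i1 i2) (RintegralZl _ measurableT (sqint_L1 sf)).
  rewrite Rintegral_prob_cst; ring.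
by apply: Rintegral_ge0 => w _; exact: sqr_ge0.
Qed.

(** Young's inequality with weight [l], applied once to the mean of the product and once to the
    product of the means; each contributes one half. The free weight is tuned in
    [cov_geometric_decay]. *)
Lemma normr_cov_le (l : R) u v : 0 < l -> sqint u -> sqint v ->
  `|cov u v| <= l * Ex (fun w => u w ^+ 2) + Ex (fun w => v w ^+ 2) / l.
Proof.
move=> l0 su sv.
have amgm (a b : R) : `|a * b| <= 2^-1 * (l * a ^+ 2 + l^-1 * b ^+ 2).
  have l0' : 0 < l^-1 by rewrite invr_gt0.
  have : 0 <= l^-1 * (l * `|a| - `|b|) ^+ 2 by rewrite mulr_ge0 ?sqr_ge0 // ltW.
  rewrite normrM -(real_normK (num_real a)) -(real_normK (num_real b)).
  have -> : l^-1 * (l * `|a| - `|b|) ^+ 2 =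
    l * `|a| ^+ 2 + l^-1 * `|b| ^+ 2 - 2 * (`|a| * `|b|).
    by field; rewrite gt_eqF.
  lra.
have i1 := integrable_scale l (proj2 su); have i2 := integrable_scale l^-1 (proj2 sv).
have i3 := integrable_scale 2^-1 (integrable_add i1 i2).
have e3 : Ex (fun w => 2^-1 * (l * u w ^+ 2 + l^-1 * v w ^+ 2)) =
   2^-1 * (l * Ex (fun w => u w ^+ 2) + l^-1 * Ex (fun w => v w ^+ 2)).
  rewrite (RintegralZl _ measurableT (integrable_add i1 i2)).
  rewrite (RintegralD measurableT i1 i2) (RintegralZl _ measurableT (proj2 su)).
  by rewrite (RintegralZl _ measurableT (proj2 sv)).
have h1 : `|Ex (fun w => u w * v w)| <=
   2^-1 * (l * Ex (fun w => u w ^+ 2) + l^-1 * Ex (fun w => v w ^+ 2)).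
  rewrite -e3; have iuv := sqint_mul su sv.
  apply: (le_trans (le_normr_Rintegral measurableT iuv)).
  apply: Rintegral_le => //; first exact: integrable_norm iuv.
have h2 := amgm (Ex u) (Ex v).
have hu := ler_wpM2l (ltW l0) (sqr_Rintegral_le su).
have l0' : 0 <= l^-1 by rewrite invr_ge0 ltW.
have hv := ler_wpM2l l0' (sqr_Rintegral_le sv).
rewrite /cov (le_trans (ler_normB _ _)) // [_ / l]mulrC.
lra.
Qed.

End second_moments.

(** * Covariance inequality under mixing *)

Section ladder.
Variable R : realType.
Implicit Types (h y : R) (K : nat).

(* For [0 <= y], this is [Num.min y (K h)] rounded down to a multiple of [h]. *)
Definition ladder h K y : R := h * \sum_(i < K) (i.+1%:R * h <= y)%R%:R.

Lemma ladderS h K y :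
  ladder h K.+1 y = ladder h K y + h * (K.+1%:R * h <= y)%R%:R.
Proof. by rewrite /ladder big_ord_recr mulrDr. Qed.

Lemma ladder_lt0 h K y : 0 < h -> y <= 0 -> ladder h K y = 0.
Proof.
move=> h0 y0; rewrite /ladder big1 ?mulr0 // => i _.
by rewrite leNgt (le_lt_trans y0) // mulr_gt0 // ltr0n.
Qed.

Lemma ladder_top h K y : 0 < h -> K%:R * h <= y -> ladder h K y = K%:R * h.
Proof.
move=> h0 Ky; rewrite /ladder (eq_bigr (fun=> 1)); last first.
  move=> i _; rewrite (le_trans _ Ky) // ler_wpM2r ?ler_nat // ltW //.
by rewrite sumr_const card_ord mulrC.
Qed.

Lemma ladder_approx h K y : 0 < h -> 0 <= y -> y <= K%:R * h ->
  0 <= ladder h K y <= y /\ y - ladder h K y <= h.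
Proof.
move=> h0 y0; elim: K => [|K IH] yK.
  rewrite /ladder big_ord0 mulr0 lexx y0 subr0; split=> //.
  by rewrite (le_trans yK) // mul0r ltW.
have [yKS|] := leP (K.+1%:R * h) y.
  have -> : y = K.+1%:R * h by apply/le_anti; rewrite yK yKS.
  by rewrite ladder_top // lexx andbT subrr mulr_ge0 ?(ltW h0).
move=> y_lt; rewrite ladderS (lt_geF y_lt) mulr0 addr0.
have [yK'|/ltW Ky] := leP y (K%:R * h); first exact: IH.
rewrite ladder_top // mulr_ge0 ?ler0n ?(ltW h0) //=; split=> //.
by move: y_lt; rewrite -natr1; lra.
Qed.

Lemma ladder_bounds h K y : 0 < h -> 0 <= y -> 0 <= ladder h K y <= y.
Proof.
move=> h0 y0; have [yK|/ltW Ky] := leP y (K%:R * h).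
  by case: (ladder_approx h0 y0 yK).
by rewrite ladder_top // Ky andbT mulr_ge0 // ltW.
Qed.

(** [ladder] vanishes on nonpositive numbers; this is its odd extension. *)
Definition ladder2 h K y : R := ladder h K y - ladder h K (- y).

Lemma ladder2N h K y : ladder2 h K (- y) = - ladder2 h K y.
Proof. by rewrite /ladder2 opprK opprB. Qed.

Lemma ladder2_pos h K y : 0 < h -> 0 <= y -> ladder2 h K y = ladder h K y.
Proof.
by move=> h0 y0; rewrite /ladder2 [X in _ - X]ladder_lt0 ?subr0 // oppr_le0.
Qed.

Lemma ladder2_sqr_le h K y : 0 < h -> ladder2 h K y ^+ 2 <= y ^+ 2.
Proof.
move=> h0; wlog y0 : y / 0 <= y.
  move=> H; have [|/ltW y0] := leP 0 y; first exact: H.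
  by rewrite -(opprK y) ladder2N sqrrN [leRHS]sqrrN H // oppr_ge0.
rewrite ladder2_pos //; have /andP[l0 ly] := ladder_bounds K h0 y0.
by rewrite ler_pXn2r.
Qed.

(** Below the height [K h] the error is at most the mesh; above it, the error is at most [|y|],
    itself at most [y ^ 2 / (K h)]. *)
Lemma ladder2_approx h K y : 0 < h -> (0 < K)%N ->
  (y - ladder2 h K y) ^+ 2 <= h ^+ 2 + y ^+ 4 / (K%:R * h) ^+ 2.
Proof.
move=> h0 K0; have M0 : 0 < K%:R * h by rewrite mulr_gt0 // ltr0n.
wlog y0 : y / 0 <= y.
  move=> H; have [|/ltW y0] := leP 0 y; first exact: H.
  rewrite -(opprK y) ladder2N -opprD sqrrN -[X in _ <= _ + X / _]/((- - y) ^+ 4).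
  by rewrite [(- - y) ^+ 4](_ : _ = (- y) ^+ 4) ?H ?oppr_ge0 //; ring.
rewrite ladder2_pos //; have [yK|/ltW Ky] := leP y (K%:R * h).
  have [/andP[l0 ly] lh] := ladder_approx h0 y0 yK.
  rewrite -[leLHS]addr0 lerD //.
    by rewrite ler_pXn2r ?nnegrE ?subr_ge0 // ltW.
  by rewrite divr_ge0 // exprn_ge0 // ltW.
rewrite ladder_top // -[leLHS]add0r lerD ?sqr_ge0 //.
rewrite ler_pdivlMr ?exprn_gt0 // -exprMn -[4%N]/(2 * 2)%N exprM.
rewrite ler_pXn2r ?nnegrE ?mulr_ge0 ?subr_ge0 ?sqr_ge0 ?(ltW M0) ?(ltW h0) //.
by rewrite expr2; apply: ler_pM; rewrite ?subr_ge0 ?(ltW M0) ?(ltW h0) // ?lerBlDr ?lerDl ?(ltW M0).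
Qed.

End ladder.

Section mixing_covariance.
Context d (T : measurableType d) (R : realType) (P : probability T R).
Implicit Types f g u v : T -> R.

Local Notation L1 f := (P.-integrable setT (EFin \o f)).
Local Notation Ex f := (Rintegral P setT f).

Lemma measurable_superlevel f (s : R) : measurable_fun setT f ->
  measurable [set w | s <= f w].
Proof.
move=> mf; rewrite -[X in measurable X]setTI.
have -> : [set w | s <= f w] = f @^-1` `[s, +oo[%classic.
  by apply/seteqP; split=> w /=; rewrite in_itv /= andbT.
exact: mf.
Qed.

Lemma measurable_strict_superlevel f (s : R) : measurable_fun setT f ->
  measurable [set w | s < f w].
Proof.
move=> mf; rewrite -[X in measurable X]setTI.
have -> : [set w | s < f w] = f @^-1` `]s, +oo[%classic.
  by apply/seteqP; split=> w /=; rewrite in_itv /= andbT.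
exact: mf.
Qed.

Lemma sqint_ladder h K f : measurable_fun setT f ->
  sqint P (fun w => ladder h K (f w)).
Proof.
move=> mf; rewrite /ladder; apply: sqintZ; apply: sqint_sum => i.
by apply: sqint_bool; exact: measurable_superlevel.
Qed.

(** Each of the [K] steps is [h] times the indicator of a superlevel set and adds at most
    [h * a]. *)
Lemma cov_ladder_le h K (a : R) f u : 0 < h -> measurable_fun setT f -> sqint P u ->
  (forall s, `|cov P (fun w => (s <= f w)%R%:R) u| <= a) ->
  `|cov P (fun w => ladder h K (f w)) u| <= K%:R * h * a.
Proof.
move=> h0 mf su ha; elim: K => [|K IH].
  have -> : (fun w => ladder h 0 (f w)) = (fun w => 0 * u w).
    by apply/funext => w; rewrite /ladder big_ord0 mulr0 mul0r.
  by rewrite covZl // !mul0r normr0.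
have -> : (fun w => ladder h K.+1 (f w)) =
    (fun w => ladder h K (f w) + h * (K.+1%:R * h <= f w)%R%:R).
  by apply/funext => w; rewrite ladderS.
have sb : sqint P (fun w => (K.+1%:R * h <= f w)%R%:R).
  by apply: sqint_bool; exact: measurable_superlevel.
rewrite covDl //; [|exact: sqint_ladder|exact: sqintZ].
have -> : K.+1%:R * h * a = K%:R * h * a + h * a by rewrite -natr1 !mulrDl mul1r.
rewrite (le_trans (ler_normD _ _)) // lerD // (covZl h sb su).
by rewrite normrM gtr0_norm // ler_wpM2l // ltW.
Qed.

(** Treats [f] and [- f] uniformly, so that superlevel sets cover both tails. *)
Definition tail_sign (e : bool) f : T -> R := fun w => (-1) ^+ e * f w.

(* Both functions are replaced by the step functions [ladder2], whose
   covariance is a double sum of covariances of superlevel sets. *)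
Lemma cov_mixing_le (f g : T -> R) (h l a M4 : R) (K : nat) :
  0 < h -> 0 < l -> (0 < K)%N ->
  measurable_fun setT f -> measurable_fun setT g ->
  L1 (fun w => f w ^+ 4) -> L1 (fun w => g w ^+ 4) ->
  Ex (fun w => f w ^+ 4) <= M4 -> Ex (fun w => g w ^+ 4) <= M4 ->
  (forall e e' s t, `|cov P (fun w => (s <= tail_sign e f w)%R%:R)
                          (fun w => (t <= tail_sign e' g w)%R%:R)| <= a) ->
  `|cov P f g| <= 4 * (K%:R * h) ^+ 2 * a
     + 2 * (l * (h ^+ 2 + M4 / (K%:R * h) ^+ 2) + (1 + M4) / l).
Proof.
move=> h0 l0 K0 mf mg f4 g4 hf hg ha.
have M0 : 0 < K%:R * h by rewrite mulr_gt0 // ltr0n.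
have sqr4 (u : T -> R) : measurable_fun setT u -> L1 (fun w => u w ^+ 4) ->
    Ex (fun w => u w ^+ 4) <= M4 ->
    [/\ sqint P u, Ex (fun w => u w ^+ 2) <= 1 + M4,
        sqint P (fun w => ladder2 h K (u w)),
        Ex (fun w => ladder2 h K (u w) ^+ 2) <= 1 + M4 &
        Ex (fun w => (u w - ladder2 h K (u w)) ^+ 2) <=
          h ^+ 2 + M4 / (K%:R * h) ^+ 2].
  move=> mu u4 hu.
  have [su eu] := pow4_sqint mu u4.
  have {}eu : Ex (fun w => u w ^+ 2) <= 1 + M4 by apply: (le_trans eu); rewrite lerD2l.
  have mN : measurable_fun setT (fun w => - u w) by exact: measurable_funN.
  have sl : sqint P (fun w => ladder2 h K (u w)).
    by rewrite /ladder2; apply: sqintB; exact: sqint_ladder.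
  split=> //.
  - apply: le_trans eu; apply: Rintegral_le (proj2 sl) (proj2 su) _ => w.
    exact: ladder2_sqr_le.
  - have i2 := integrable_scale ((K%:R * h) ^+ 2)^-1 u4.
    have i3 := integrable_add (integrable_const P (h ^+ 2)) i2.
    apply: (@le_trans _ _ (Ex (fun w => h ^+ 2 + ((K%:R * h) ^+ 2)^-1 * u w ^+ 4))).
      apply: Rintegral_le (proj2 (sqintB su sl)) i3 _ => w.
      by rewrite [_ ^-1 * _]mulrC ladder2_approx.
    rewrite (RintegralD measurableT (integrable_const P _) i2).
    rewrite Rintegral_prob_cst (RintegralZl _ measurableT u4) lerD2l mulrC.
    by rewrite ler_wpM2r // invr_ge0 sqr_ge0.
have [sf vf slf vlf df] := sqr4 f mf f4 hf.
have [sg vg slg vlg dg] := sqr4 g mg g4 hg.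
set lf := fun w => ladder2 h K (f w) in slf vlf df.
set lg := fun w => ladder2 h K (g w) in slg vlg dg.
(* Bilinearity, replacing one argument at a time; the first two terms are approximation errors. *)
have -> : cov P f g = cov P (fun w => f w - lf w) g
    + (cov P (fun w => g w - lg w) lf + cov P lg lf).
  rewrite covBl // covBl // ![cov P _ lf]covC; ring.
have bound u v : sqint P u -> sqint P v ->
   Ex (fun w => u w ^+ 2) <= h ^+ 2 + M4 / (K%:R * h) ^+ 2 ->
   Ex (fun w => v w ^+ 2) <= 1 + M4 ->
   `|cov P u v| <= l * (h ^+ 2 + M4 / (K%:R * h) ^+ 2) + (1 + M4) / l.
  move=> su sv hu hv; apply: (le_trans (normr_cov_le l0 su sv)).
  by apply: lerD; [rewrite ler_pM2l|rewrite ler_pM2r // invr_gt0].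
have b1 := bound _ _ (sqintB sf slf) sg df vg.
have b2 := bound _ _ (sqintB sg slg) slf dg vlf.
have b3 : `|cov P lg lf| <= 4 * (K%:R * h) ^+ 2 * a.
  have mt e (u : T -> R) : measurable_fun setT u -> measurable_fun setT (tail_sign e u).
    by move=> mu; apply: measurable_funM.
  have lE (u : T -> R) :
      (fun w => ladder2 h K (u w)) = (fun w => ladder h K (tail_sign false u w)
         - ladder h K (tail_sign true u w)).
    by apply/funext => w; rewrite /ladder2 /tail_sign expr0 expr1 mul1r mulN1r.
  (* One bound for each of the four sign combinations, whence the factor 4. *)
  have lad e e' : `|cov P (fun w => ladder h K (tail_sign e' g w))
      (fun w => ladder h K (tail_sign e f w))| <= K%:R * h * (K%:R * h * a).
    apply: cov_ladder_le => //; [exact: mt|apply: sqint_ladder; exact: mt|].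
    move=> t; rewrite covC; apply: cov_ladder_le => //; first exact: mt.
    by apply: sqint_bool; apply: measurable_superlevel; exact: mt.
  have sl e (u : T -> R) : measurable_fun setT u ->
      sqint P (fun w => ladder h K (tail_sign e u w)).
    by move=> mu; apply: sqint_ladder; exact: mt.
  rewrite /lg /lf !lE covBl; [|exact: sl|exact: sl|by apply: sqintB; exact: sl].
  rewrite !(covC P _ (fun w => _ - _)) !covBl; try exact: sl.
  rewrite !(covC P (fun w => ladder h K (tail_sign _ f w))).
  have := lad false false; have := lad false true.
  have := lad true false; have := lad true true.
  rewrite !ler_norml; set X := K%:R * h * (K%:R * h * a).
  have -> : 4 * (K%:R * h) ^+ 2 * a = 4 * X by rewrite /X; ring.
  move=> /andP[? ?] /andP[? ?] /andP[? ?] /andP[? ?].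
  by apply/andP; split; lra.
apply: (le_trans (ler_normD _ _)); rewrite addrC [2 * _]mulr_natl mulr2n.
rewrite [leRHS]addrC -addrA addrC lerD //.
by rewrite (le_trans (ler_normD _ _)) // lerD.
Qed.

End mixing_covariance.

(** * Moments from the Weibull tails, and variance of a sum *)

Section moments.
Context d (T : measurableType d) (R : realType) (P : probability T R).
Implicit Types f g u v : T -> R.

Local Notation L1 f := (P.-integrable setT (EFin \o f)).
Local Notation Ex f := (Rintegral P setT f).

(** If [|y|] lies in []2^i, 2^(i+1)]], the single term of index [i] already dominates [y ^ 4]; if
    [|y| <= 1], the constant 1 does. *)
Lemma dyadic_pow4_le (y : R) (n : nat) : `|y| <= 2 ^+ n ->
  y ^+ 4 <= 1 + \sum_(0 <= i < n) 16 ^+ i.+1 * (2 ^+ i < `|y|)%R%:R.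
Proof.
have -> : y ^+ 4 = `|y| ^+ 4 by rewrite -normrX ger0_norm // -[4%N]/(2 * 2)%N exprM sqr_ge0.
elim: n => [|n IH] hy.
  by rewrite big_nil addr0 exprn_ile1 // -[X in _ <= X](expr0 2).
rewrite big_nat_recr //= addrA.
have [y_gt|y_le] := ltP (2 ^+ n) `|y|; last by rewrite mulr0 addr0 IH.
rewrite mulr1 -[leLHS]add0r lerD //.
  by rewrite addr_ge0 // sumr_ge0.
have -> : 16 ^+ n.+1 = (2 ^+ n.+1) ^+ 4 :> R.
  by rewrite exprAC; congr (_ ^+ _); rewrite -natrX.
by rewrite ler_pXn2r // nnegrE exprn_ge0.
Qed.

(** Integrating the dyadic bound gives the series of [16^(i+1) C / 32^i = 16 C / 2^i], whose sum is
    [32 C]; this is why the tails are asked to decay like [32^-i]. *)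
Lemma fourth_moment_le f (C : R) : 0 <= C -> measurable_fun setT f ->
  (forall i : nat, (P [set w | (2 ^+ i < `|f w|)%R] <= (C / 32 ^+ i)%:E)%E) ->
  L1 (fun w => f w ^+ 4) /\ Ex (fun w => f w ^+ 4) <= 1 + 32 * C.
Proof.
move=> C0 mf tail.
have m4 : measurable_fun setT (fun w => f w ^+ 4) by exact: measurable_funX.
have f4_ge0 w : 0 <= f w ^+ 4 by rewrite -[4%N]/(2 * 2)%N exprM sqr_ge0.
have mA i : measurable [set w | (2 ^+ i < `|f w|)%R].
  by apply: measurable_strict_superlevel; exact: measurableT_comp.
pose F i w : \bar R := (16 ^+ i.+1 * (2 ^+ i < `|f w|)%R%:R)%:E.
have F0 i w : (0 <= F i w)%E by rewrite lee_fin mulr_ge0 // exprn_ge0.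
have mF i : measurable_fun setT (F i).
  apply/measurable_EFinP; apply: measurable_funM => //.
  exact: (proj1 (sqint_bool P (mA i))).
have intF i : (\int[P]_w F i w <= (16 * C / 2 ^+ i)%:E)%E.
  have -> : (\int[P]_w F i w = (16 ^+ i.+1)%:E * P [set w | (2 ^+ i < `|f w|)%R])%E.
    rewrite /F; under eq_integral do rewrite EFinM.
    rewrite ge0_integralZl //; last first.
      by apply/measurable_EFinP; exact: (proj1 (sqint_bool P (mA i))).
    by rewrite integral_bool.
  have -> : (16 * C / 2 ^+ i)%:E = ((16 ^+ i.+1)%:E * (C / 32 ^+ i)%:E)%E.
    rewrite -EFinM; congr (_%:E).
    have -> : (32 : R) = 16 * 2 by rewrite -natrM.
    by rewrite exprMn exprS; field; rewrite !expf_neq0.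
  by apply: lee_wpmul2l => //; rewrite lee_fin exprn_ge0.
have bound : (\int[P]_w (f w ^+ 4)%:E <= (1 + 32 * C)%:E)%E.
  apply: (@le_trans _ _ (\int[P]_w (1 + \sum_(0 <= i <oo) F i w))%E).
    apply: ge0_le_integral => //.
    - by move=> w _; rewrite lee_fin.
    - exact/measurable_EFinP.
    - apply: emeasurable_funD => //; apply: ge0_emeasurable_sum => //.
    - move=> w _.
      have := @truncnS_gt R `|f w|.
      set n := (Num.truncn `|f w|).+1 => fn.
      have : `|f w| <= 2 ^+ n.
        apply: (le_trans (ltW fn)); rewrite -natrX ler_nat.
        exact: ltnW (ltn_expl _ _).
      move=> /dyadic_pow4_le h; apply: (@le_trans _ _ (1 + \sum_(0 <= i < n) F i w)%E).
        by rewrite sumEFin -EFinD lee_fin.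
      by apply: leeD => //; exact: nneseries_lim_ge.
  rewrite ge0_integralD //; last 2 first.
  - by move=> w _; exact: nneseries_ge0.
  - exact: ge0_emeasurable_sum.
  rewrite integral_cst //= probability_setT mule1 EFinD leeD2l //.
  rewrite integral_nneseries //.
  apply: lime_le; first by apply: is_cvg_nneseries => i _ _; exact: integral_ge0.
  apply: nearW => n.
  apply: (@le_trans _ _ (\sum_(0 <= i < n) (16 * C / 2 ^+ i)%:E)%E).
    by apply: lee_sum.
  rewrite sumEFin lee_fin.
  suff -> : \sum_(0 <= i < n) (16 * C / 2 ^+ i) = 32 * C * (1 - (2 ^+ n)^-1).
    by rewrite mulrBr mulr1 gerBl mulr_ge0 ?mulr_ge0 // invr_ge0 exprn_ge0.
  elim: n => [|n IH]; first by rewrite big_nil expr0 invr1 subrr mulr0.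
  by rewrite big_nat_recr //= IH exprS; field; rewrite expf_neq0.
have fin : L1 (fun w => f w ^+ 4).
  apply/integrableP; split; first exact/measurable_EFinP.
  under eq_integral do rewrite /= ger0_norm //.
  exact: le_lt_trans bound (ltry _).
split=> //; rewrite -lee_fin fineK //; exact: integrable_fin_num.
Qed.

(** From [exp x >= (x / k)^k] with [x = (2^i / b)^gamma]: once [gamma k >= 5], the power [x^k] grows
    at least like [2^(5 i) = 32^i]. *)
Lemma weibull_tail_dyadic (gamma b : R) : 0 < gamma -> 0 < b ->
  exists2 C, 0 <= C & forall i : nat,
    expR (1 - (2 ^+ i / b) `^ gamma) <= C / 32 ^+ i.
Proof.
move=> g0 b0.
pose k := (Num.truncn (5 / gamma)).+1.
have k0 : (0 : R) < k%:R by rewrite ltr0n.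
have gk : 5 <= gamma * k%:R.
  rewrite mulrC -ler_pdivrMr //; exact: ltW (truncnS_gt _).
exists (expR 1 * (k%:R ^+ k * b `^ (gamma * k%:R))).
  by rewrite mulr_ge0 ?expR_ge0 // mulr_ge0 ?exprn_ge0 ?powR_ge0 // ltW.
move=> i; rewrite expRD -mulrA ler_pM2l ?expR_gt0 //.
set x := (2 ^+ i / b) `^ gamma.
have pos : (0 : R) < 2 ^+ i by rewrite exprn_gt0.
have xk : x ^+ k = (2 ^+ i) `^ (gamma * k%:R) / b `^ (gamma * k%:R).
  rewrite /x -powR_mulrn ?powR_ge0 // -powRrM powRM ?ltW ?invr_gt0 //.
  by rewrite -powR_inv1 ?ltW // -powRrM mulN1r powRN.
have x0 : 0 < x by rewrite powR_gt0 // divr_gt0.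
have lower : (x / k%:R) ^+ k <= expR x.
  have -> : expR x = expR (x / k%:R) ^+ k.
    by rewrite -expRM_natl mulrC divfK // gt_eqF.
  rewrite ler_pXn2r ?nnegrE ?expR_ge0 ?divr_ge0 ?ltW //.
  by apply: lt_le_trans (expR_ge1Dx _); rewrite ltrDr.
have p32 : 32 ^+ i <= (2 ^+ i) `^ (gamma * k%:R).
  have -> : 32 ^+ i = (2 ^+ i) `^ 5%:R :> R.
    by rewrite powR_mulrn ?ltW // exprAC; congr (_ ^+ _); rewrite -natrX.
  by apply: ler_powR => //; rewrite exprn_ege1 // ler1n.
rewrite expRN -[leLHS]mul1r ler_pdivrMr ?expR_gt0 //.
apply: le_trans (ler_wpM2l _ lower); last first.
  by rewrite divr_ge0 ?exprn_ge0 // mulr_ge0 ?exprn_ge0 ?powR_ge0 // ltW.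
rewrite expr_div_n xk.
have b_gt0 : 0 < b `^ (gamma * k%:R) by exact: powR_gt0.
have -> : k%:R ^+ k * b `^ (gamma * k%:R) / 32 ^+ i *
   ((2 ^+ i) `^ (gamma * k%:R) / b `^ (gamma * k%:R) / k%:R ^+ k) =
   (2 ^+ i) `^ (gamma * k%:R) / 32 ^+ i.
  by field; rewrite !expf_neq0 ?gt_eqF.
by rewrite ler_pdivlMr ?exprn_gt0 // mul1r.
Qed.

Lemma cov_geometric_decay (c rho M4 : R) : 0 < c -> 0 < rho < 1 -> 0 <= M4 ->
  let q := Num.sqrt (Num.sqrt rho) in
  forall f g (n : nat),
  measurable_fun setT f -> measurable_fun setT g ->
  L1 (fun w => f w ^+ 4) -> L1 (fun w => g w ^+ 4) ->
  Ex (fun w => f w ^+ 4) <= M4 -> Ex (fun w => g w ^+ 4) <= M4 ->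
  (forall e e' s t, `|cov P (fun w => (s <= tail_sign e f w)%R%:R)
       (fun w => (t <= tail_sign e' g w)%R%:R)| <= c * rho ^+ n) ->
  `|cov P f g| <= (16 * c + 4 * (1 + M4)) * q ^+ n.
Proof.
move=> c0 /andP[rho0 rho1] M40 q f g n mf mg f4 g4 hf hg hcov.
have q0 : 0 < q by rewrite !sqrtr_gt0.
have q1 : q < 1.
  by rewrite -(sqrtr1 R) ltr_sqrt // -[X in _ < X](sqrtr1 R) ltr_sqrt.
have q4 : q ^+ 4 = rho.
  by rewrite -[4%N]/(2 * 2)%N exprM !sqr_sqrtr ?sqrtr_ge0 // ltW.
set h := q ^+ n; have h0 : 0 < h by rewrite exprn_gt0.
have h1 : h <= 1 by rewrite exprn_ile1 // ltW.
(* With [rho^n = h^4], this puts [K h] between [1 / h] and [2 / h]. Together with the weight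
   [l = 1 / h], every term of [cov_mixing_le] becomes [O(h)]. *)
pose K := (Num.truncn (h ^- 2)).+1.
have hV : 1 <= h ^- 2.
  by rewrite invf_ge1 ?exprn_gt0 // exprn_ile1 // ltW.
have Klo : h ^- 2 <= K%:R by exact: ltW (truncnS_gt _).
have Khi : K%:R <= 2 * h ^- 2.
  have h2 : 0 <= h ^- 2 by apply: le_trans hV.
  have := truncn_itv h2 => /andP[tr _].
  by rewrite /K -natr1 mulr_natl mulr2n lerD.
have rhoE : rho ^+ n = h ^+ 4 by rewrite -q4 /h -!exprM mulnC.
rewrite {}rhoE in hcov; clearbody h.
have hVgt0 : 0 < h^-1 by rewrite invr_gt0.
have := cov_mixing_le (K := K) h0 hVgt0 isT mf mg f4 g4 hf hg hcov.
move=> /le_trans; apply.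
have KhLo : h^-1 <= K%:R * h.
  by rewrite -ler_pdivrMr // -expr2 -exprVn in Klo *.
have KhHi : K%:R * h <= 2 * h^-1.
  rewrite -ler_pdivlMr //; apply: (le_trans Khi); rewrite -mulrA -invfM.
  by rewrite expr2.
have hne : h != 0 by rewrite gt_eqF.
have b1 : 4 * (K%:R * h) ^+ 2 * (c * h ^+ 4) <= 16 * c * h.
  apply: (@le_trans _ _ (4 * (2 * h^-1) ^+ 2 * (c * h ^+ 4))).
    rewrite ler_wpM2r ?mulr_ge0 ?exprn_ge0 ?(ltW c0) ?(ltW h0) //.
    rewrite ler_wpM2l // ler_pXn2r ?nnegrE ?mulr_ge0 ?(ltW h0) ?(ltW hVgt0) //.
  have -> : 4 * (2 * h^-1) ^+ 2 * (c * h ^+ 4) = 16 * c * h * h by field.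
  by rewrite ler_piMr // !mulr_ge0 // ltW.
have b2 : M4 / (K%:R * h) ^+ 2 <= M4 * h ^+ 2.
  have Kh0 : 0 < K%:R * h by rewrite mulr_gt0 // ltr0n.
  rewrite ler_wpM2l // -[X in _ <= X]invrK lef_pV2 ?posrE ?invr_gt0 ?exprn_gt0 //.
  by rewrite -exprVn ler_pXn2r ?nnegrE ?(ltW Kh0) ?(ltW hVgt0).
have b3 : h^-1 * (h ^+ 2 + M4 / (K%:R * h) ^+ 2) <= (1 + M4) * h.
  apply: (@le_trans _ _ (h^-1 * (h ^+ 2 + M4 * h ^+ 2))).
    by rewrite ler_wpM2l ?(ltW hVgt0) // lerD2l.
  by have -> : h^-1 * (h ^+ 2 + M4 * h ^+ 2) = (1 + M4) * h by field.
rewrite invrK; lra.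
Qed.

(** Induction on [N]: the new term adds its square and twice its products with the earlier terms, at
    most [C + 2 C q / (1 - q) = C (1 + q) / (1 - q)]. *)
Lemma variance_sum_le (Y : nat -> T -> R) (C q : R) (a N : nat) :
  0 <= C -> 0 < q < 1 ->
  (forall t, (a <= t < a + N)%N -> sqint P (Y t)) ->
  (forall s t, (a <= s)%N -> (s <= t < a + N)%N ->
     Ex (fun w => Y s w * Y t w) <= C * q ^+ (t - s)) ->
  Ex (fun w => (\sum_(a <= t < a + N) Y t w) ^+ 2) <= 2 * C / (1 - q) * N%:R.
Proof.
move=> C0 /andP[q0 q1]; have q1' : 0 < 1 - q by rewrite subr_gt0.
elim: N => [|N IH] sY cY.
  rewrite mulr0; under eq_Rintegral do rewrite addn0 big_geq // expr0n.
  by rewrite Rintegral_prob_cst.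
have sN : sqint P (Y (a + N)%N) by apply: sY; lia.
have sY' t : (a <= t < a + N)%N -> sqint P (Y t) by move=> ?; apply: sY; lia.
have {}IH := IH sY' (fun s t as_ st => cY s t as_ ltac:(lia)).
(* The right-hand side is [C] times the closed form of [q^(N-k+1) + ... + q^N]. *)
have partial k : (k <= N)%N ->
    sqint P (fun w => \sum_(a <= t < a + k) Y t w) /\
    Ex (fun w => (\sum_(a <= t < a + k) Y t w) * Y (a + N)%N w) <=
      C * (q ^+ (N - k).+1 - q ^+ N.+1) / (1 - q).
  elim: k => [|k IHk] kN.
    split.
      under eq_fun do rewrite addn0 big_geq //; exact: sqint_cst.
    under eq_Rintegral do rewrite addn0 big_geq // mul0r.
    by rewrite Rintegral_prob_cst subn0 subrr mulr0 mul0r.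
  have [sk ck] := IHk (ltnW kN).
  have sYk : sqint P (Y (a + k)%N) by apply: sY; lia.
  split.
    under eq_fun do rewrite addnS big_nat_recr ?leq_addr //=.
    exact: sqintD.
  under eq_Rintegral do rewrite addnS big_nat_recr ?leq_addr //= mulrDl.
  rewrite (RintegralD measurableT (sqint_mul sk sN) (sqint_mul sYk sN)).
  have := cY (a + k)%N (a + N)%N (leq_addr _ _) ltac:(lia).
  rewrite subnDl => hk; apply: (le_trans (lerD ck hk)).
  have -> : q ^+ (N - k.+1).+1 = q ^+ (N - k) by congr (_ ^+ _); lia.
  rewrite [X in X <= _](_ : _ = C * (q ^+ (N - k) - q ^+ N.+1) / (1 - q)) //.
  by rewrite exprS; field; rewrite gt_eqF.
have [sS cS] := partial N (leqnn _).
have sq_le : Ex (fun w => Y (a + N)%N w ^+ 2) <= C.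
  have := cY (a + N)%N (a + N)%N (leq_addr _ _) ltac:(lia).
  by rewrite subnn expr0 mulr1; under eq_Rintegral do rewrite -expr2.
have -> : Ex (fun w => (\sum_(a <= t < a + N.+1) Y t w) ^+ 2) =
    Ex (fun w => (\sum_(a <= t < a + N) Y t w) ^+ 2 +
       (2 * ((\sum_(a <= t < a + N) Y t w) * Y (a + N)%N w) + Y (a + N)%N w ^+ 2)).
  apply: eq_Rintegral => w _; rewrite addnS big_nat_recr ?leq_addr //=; ring.
have i2 := integrable_scale 2 (sqint_mul sS sN).
rewrite (RintegralD measurableT (proj2 sS) (integrable_add i2 (proj2 sN))).
rewrite (RintegralD measurableT i2 (proj2 sN)).
rewrite (RintegralZl _ measurableT (sqint_mul sS sN)) -(natr1 N) mulrDr mulr1.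
apply: lerD IH _.
have cS' : Ex (fun w => (\sum_(a <= t < a + N) Y t w) * Y (a + N)%N w) <=
    C * q / (1 - q).
  apply: (le_trans cS); rewrite subnn expr1 ler_pM2r ?invr_gt0 //.
  by rewrite ler_wpM2l // gerBl exprn_ge0 // ltW.
apply: (@le_trans _ _ (2 * (C * q / (1 - q)) + C)).
  by apply: lerD => //; rewrite ler_pM2l.
have -> : 2 * (C * q / (1 - q)) + C = (C * (1 + q)) / (1 - q).
  by field; rewrite gt_eqF.
by rewrite ler_pM2r ?invr_gt0 // mulrC ler_wpM2r //; lra.
Qed.

End moments.

(** * Second moment of the scatter matrices *)

Section process_moments.
Context (R : realType) (d : measure_display) (Omega : measurableType d)
  (P : probability Omega R) (p : nat) (X : int -> Omega -> 'cV[R]_p).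

Local Notation L1 f := (P.-integrable setT (EFin \o f)).
Local Notation Ex f := (Rintegral P setT f).

Definition prod_rv (k l : 'I_p) (t : int) : Omega -> R :=
  fun w => coord_rv X k t w * coord_rv X l t w.

(** On [Omega] equipped with the generated sigma-algebra, the coordinates at times in [D] are
    measurable, hence so are their products. *)
Lemma sigma_field_superlevel (D : set int) (t : int) k l (e : bool) (s : R) :
  D t -> sigma_field X D [set w | s <= tail_sign e (prod_rv k l t) w].
Proof.
move=> Dt; set G := [set A | exists t k B,
  [/\ D t, measurable B & A = coord_rv X k t @^-1` B] ].
have mc k' : measurable_fun setT
    (coord_rv X k' t : g_sigma_algebraType G -> R).
  move=> _ B mB; rewrite setTI; apply: sub_gen_smallest.
  by exists t, k', B.
have : measurable_fun setT
    (tail_sign e (prod_rv k l t) : g_sigma_algebraType G -> R).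
  by apply: measurable_funM => //; apply: measurable_funM.
by move=> /(measurable_superlevel s).
Qed.

Hypothesis mX : forall k t, measurable_fun setT (coord_rv X k t).

Lemma measurable_prod_rv k l t : measurable_fun setT (prod_rv k l t).
Proof. exact: measurable_funM. Qed.

(** The covariance of two indicators is [P (A B) - P A P B], with [A] in the past of [r] and [B] in
    the future of [r + n]. *)
Lemma cov_superlevel_le (a : R) (n : nat) (r : int) k l e e' s t :
  (alpha_mix P X n <= a%:E)%E ->
  `|cov P (fun w => (s <= tail_sign e (prod_rv k l r) w)%R%:R)
          (fun w => (t <= tail_sign e' (prod_rv k l (r + n%:Z)) w)%R%:R)| <= a.
Proof.
move=> ha; pose A w := s <= tail_sign e (prod_rv k l r) w.
pose B w := t <= tail_sign e' (prod_rv k l (r + n%:Z)) w.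
have mA : measurable [set w | A w].
  by apply: measurable_superlevel; apply: measurable_funM => //; exact: measurable_prod_rv.
have mB : measurable [set w | B w].
  by apply: measurable_superlevel; apply: measurable_funM => //; exact: measurable_prod_rv.
have mAB : measurable [set w | A w && B w].
  have -> : [set w | A w && B w] = [set w | A w] `&` [set w | B w].
    by apply/seteqP; split=> w /= => [/andP[]|[-> ->]].
  exact: measurableI.
have -> : cov P (fun w => (A w)%:R) (fun w => (B w)%:R) =
   fine (P [set w | A w && B w]) - fine (P [set w | A w]) * fine (P [set w | B w]).
  rewrite /cov -!(Rintegral_bool P) //; congr (_ - _).
  by apply: eq_Rintegral => w _; rewrite -natrM mulnb.
have hmix : (`| P ([set w | A w] `&` [set w | B w])
    - P [set w | A w] * P [set w | B w] | <= a%:E)%E.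
  apply: (le_trans _ ha); apply: ereal_sup_ubound.
  exists r, [set w | A w], [set w | B w]; split=> //.
    by apply: sigma_field_superlevel => /=.
  by apply: sigma_field_superlevel => /=.
have finP C : P C \is a fin_num -> P C = (fine (P C))%:E by move=> /fineK.
have -> : [set w | A w && B w] = [set w | A w] `&` [set w | B w].
  by apply/seteqP; split=> w /= => [/andP[]|[-> ->]].
rewrite -lee_fin; apply: le_trans hmix.
rewrite [X in (_ <= `|X - _|)%E]finP ?fin_num_measure //; last exact: measurableI.
rewrite [X in (_ <= `|_ - X * _|)%E]finP ?fin_num_measure //.
by rewrite [X in (_ <= `|_ - _ * X|)%E]finP ?fin_num_measure.
Qed.

End process_moments.

Section scatter_moments.
Context (R : realType).

(** The constant is chosen before the process and its dimension, so one [K] serves all sample sizes.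
    The factor [p ^ 2] counts the entries and [N] comes from [variance_sum_le]. *)
Lemma scatter_second_moment (calpha rho gamma b : R) :
  0 < calpha -> 0 < rho -> rho < 1 -> 0 < gamma -> 0 < b ->
  exists2 K : R, 0 < K & forall (d : measure_display) (Omega : measurableType d)
    (P : probability Omega R) (p : nat) (X : int -> Omega -> 'cV[R]_p)
    (T m : nat) (Tstar : nat -> nat) (Sigma : nat -> 'M[R]_p) (j a N : nat),
  change_point_model P X T m Tstar Sigma ->
  assumption1 P X calpha rho gamma b ->
  (1 <= j <= m.+1)%N -> (1 <= a)%N -> (Tstar j.-1 <= a)%N -> (a + N <= Tstar j)%N ->
  let Z w := mxdot (scatter (fun t => X t%:Z w) (Sigma j) a N)
                   (scatter (fun t => X t%:Z w) (Sigma j) a N) in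
  P.-integrable setT (EFin \o Z) /\
  Rintegral P setT Z <= K * p%:R ^+ 2 * N%:R.
Proof.
move=> c0 r0 r1 g0 b0.
have [C C0 tailC] := weibull_tail_dyadic g0 b0.
pose M4 := 1 + 32 * C; have M40 : 0 <= M4 by rewrite /M4; lra.
pose q := Num.sqrt (Num.sqrt rho).
have q0 : 0 < q by rewrite !sqrtr_gt0.
have q1 : q < 1.
  by rewrite -(sqrtr1 R) ltr_sqrt // -[X in _ < X](sqrtr1 R) ltr_sqrt.
pose C1 := 16 * calpha + 4 * (1 + M4).
have C10 : 0 < C1 by rewrite /C1; lra.
pose K := 2 * C1 / (1 - q).
have K0 : 0 < K by rewrite divr_gt0 ?mulr_gt0 ?subr_gt0.
exists K => // d Omega P p X T m Tstar Sigma j a N model [mix tail] hj a1 ja aj Z.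
case: model => _ mX _ _ /(_ j) mom.
have inB t : (a <= t < a + N)%N -> (Tstar j.-1 <= t < Tstar j)%N.
  by move=> /andP[h1 h2]; rewrite (leq_trans ja h1) (leq_trans h2 aj).
have t1 t : (a <= t < a + N)%N -> (1 <= t%:Z)%R.
  by move=> /andP[h1 _]; rewrite lez_nat (leq_trans a1 h1).
have inW s t : (a <= s)%N -> (s <= t < a + N)%N ->
    (a <= s < a + N)%N /\ (a <= t < a + N)%N.
  by move=> h1 /andP[h2 h3]; rewrite h1 h3 (leq_trans h1 h2) (leq_ltn_trans h2 h3).
have mU k l t : measurable_fun setT (prod_rv X k l t) by exact: measurable_prod_rv.
have mom4 k l t : (a <= t < a + N)%N ->
    P.-integrable setT (EFin \o (fun w => prod_rv X k l t%:Z w ^+ 4)) /\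
    Rintegral P setT (fun w => prod_rv X k l t%:Z w ^+ 4) <= M4.
  move=> ht; apply: fourth_moment_le => // i.
  have s0 : 0 < 2 ^+ i :> R by rewrite exprn_gt0.
  apply: (@le_trans _ _ (expR (1 - (2 ^+ i / b) `^ gamma))%:E); last first.
    by rewrite lee_fin.
  apply: le_trans (tail (2 ^+ i) k l s0); apply: ereal_sup_ubound.
  by exists t%:Z; first exact: t1.
have sqU k l t : (a <= t < a + N)%N -> sqint P (prod_rv X k l t%:Z).
  by move=> ht; have [i4 _] := mom4 k l t ht; case: (pow4_sqint (mU k l t) i4).
(* The coordinates are centered, so their covariance is the mean of the product. *)
have meanU k l t : (a <= t < a + N)%N ->
    Rintegral P setT (prod_rv X k l t%:Z) = Sigma j k l.
  move=> ht; have [mean0 covS] := mom t hj (inB t ht).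
  have := covS k l; rewrite covariance.unlock expectation.unlock.
  move: (mean0 k) (mean0 l); rewrite expectation.unlock => -> -> /= h.
  rewrite /Rintegral -[RHS]/(fine (Sigma j k l)%:E) -h; congr fine.
  by apply: eq_integral => w _; rewrite !fctE /= !subr0.
have covU k l s t : (a <= s)%N -> (s <= t < a + N)%N ->
    `|cov P (prod_rv X k l s%:Z) (prod_rv X k l t%:Z)| <= C1 * q ^+ (t - s).
  move=> has hst; have [hs ht] := inW s t has hst.
  have [s4 es4] := mom4 k l s hs; have [t4 et4] := mom4 k l t ht.
  (* The mixing bound is available for positive lags only; at lag 0 the second moment is used. *)
  have [st|st] := eqVneq s t.
    have M1 : Rintegral P setT (fun w => prod_rv X k l t%:Z w ^+ 2) <= 1 + M4.
      by have [_ /le_trans] := pow4_sqint (mU k l t) t4; apply; rewrite lerD2l.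
    rewrite st subnn expr0 mulr1.
    apply: (le_trans (normr_cov_le ltr01 (sqU k l t ht) (sqU k l t ht))).
    by rewrite mul1r divr1 /C1; lra.
  have rho01 : 0 < rho < 1 by rewrite r0 r1.
  apply: (cov_geometric_decay (M4 := M4) c0 rho01) => //.
  move=> e e' u v.
  have -> : t%:Z = s%:Z + (t - s)%N%:Z by rewrite -PoszD subnKC //; case/andP: hst.
  apply: cov_superlevel_le => //; apply: mix.
  by rewrite subn_gt0 ltn_neqAle st; case/andP: hst.
pose Y k l (t : nat) w := prod_rv X k l t%:Z w - Sigma j k l.
have sqY k l t : (a <= t < a + N)%N -> sqint P (Y k l t).
  by move=> ht; apply: sqintB; [exact: sqU|exact: sqint_cst].
have EYY k l s t : (a <= s)%N -> (s <= t < a + N)%N ->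
    Rintegral P setT (fun w => Y k l s w * Y k l t w) <= C1 * q ^+ (t - s).
  move=> has hst; have [hs ht] := inW s t has hst.
  apply: le_trans (le_trans (ler_norm _) (covU k l s t has hst)).
  rewrite le_eqVlt; apply/orP; left; apply/eqP.
  rewrite /cov !meanU //.
  have ist := sqint_mul (sqU k l s hs) (sqU k l t ht).
  have is_ := integrable_scale (- Sigma j k l) (sqint_L1 (sqU k l s hs)).
  have it := integrable_scale (- Sigma j k l) (sqint_L1 (sqU k l t ht)).
  have ic := integrable_const P (Sigma j k l ^+ 2).
  have -> : Rintegral P setT (fun w => Y k l s w * Y k l t w) =
     Rintegral P setT (fun w => prod_rv X k l s%:Z w * prod_rv X k l t%:Z w +
       (- Sigma j k l * prod_rv X k l s%:Z w +
         (- Sigma j k l * prod_rv X k l t%:Z w + Sigma j k l ^+ 2))).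
    by apply: eq_Rintegral => w _; rewrite /Y; ring.
  rewrite (RintegralD measurableT ist (integrable_add is_ (integrable_add it ic))).
  rewrite (RintegralD measurableT is_ (integrable_add it ic)).
  rewrite (RintegralD measurableT it ic).
  rewrite (RintegralZl _ measurableT (sqint_L1 (sqU k l s hs))).
  rewrite (RintegralZl _ measurableT (sqint_L1 (sqU k l t ht))).
  rewrite Rintegral_prob_cst !meanU //; ring.
have q01 : 0 < q < 1 by rewrite q0 q1.
have varY k l := variance_sum_le (ltW C10) q01 (sqY k l) (EYY k l).
have sqS k l : sqint P (fun w => \sum_(a <= t < a + N) Y k l t w).
  under eq_fun do rewrite big_nat.
  (* [sqint_sum] asks for square integrability at every index, but moments are known only inside the
     window, so the summands are set to 0 outside. *)
  have -> : (fun w => \sum_(a <= i < a + N | (a <= i < a + N)%N) Y k l i w) =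
     (fun w => \sum_(a <= i < a + N) (if (a <= i < a + N)%N then Y k l i else fun=> 0) w).
    by apply/funext => w; rewrite big_mkcond; apply: eq_bigr => i _; case: ifP.
  apply: sqint_sum => i; case: ifP => // hi; [exact: sqY|exact: sqint_cst].
have ZE w : Z w = \sum_(kl : 'I_p * 'I_p)
    (\sum_(a <= t < a + N) Y kl.1 kl.2 t w) ^+ 2.
  rewrite /Z /mxdot; apply: eq_bigr => kl _; rewrite -expr2; congr (_ ^+ 2).
  rewrite /scatter summxE; apply: eq_bigr => t _.
  by rewrite !mxE big_ord1 /Y /prod_rv /coord_rv !mxE.
have -> : Z = (fun w => \sum_(kl : 'I_p * 'I_p)
    (\sum_(a <= t < a + N) Y kl.1 kl.2 t w) ^+ 2) by apply/funext.
have intsum (r : seq ('I_p * 'I_p)) :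
  P.-integrable setT (EFin \o (fun w => \sum_(kl <- r)
     (\sum_(a <= t < a + N) Y kl.1 kl.2 t w) ^+ 2)) /\
  Rintegral P setT (fun w => \sum_(kl <- r)
     (\sum_(a <= t < a + N) Y kl.1 kl.2 t w) ^+ 2) <= (size r)%:R * (K * N%:R).
  elim: r => [|kl r [IH1 IH2]].
    split; first by under eq_fun do rewrite big_nil; exact: integrable_const.
    under eq_Rintegral do rewrite big_nil.
    by rewrite Rintegral_prob_cst mul0r.
  have i1 := proj2 (sqS kl.1 kl.2).
  split; first by under eq_fun do rewrite big_cons; exact: integrable_add.
  under eq_Rintegral do rewrite big_cons.
  rewrite (RintegralD measurableT i1 IH1) /= -natr1 mulrDl mul1r addrC.
  by rewrite lerD.
have [h1 h2] := intsum (index_enum _); split=> //.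
apply: (le_trans h2).
have -> : size (index_enum ('I_p * 'I_p)%type) = (p * p)%N.
  by rewrite -[in RHS](card_ord p) -card_prod -sum1_size -sum1_card; exact: eq_bigl.
by rewrite natrM -expr2 mulrCA mulrA.
Qed.

Lemma model_sym d (Omega : measurableType d) (P : probability Omega R) (p : nat)
    (X : int -> Omega -> 'cV[R]_p) (T m : nat) Tstar (Sigma : nat -> 'M[R]_p) j :
  change_point_model P X T m Tstar Sigma -> (1 <= j <= m.+1)%N ->
  (Sigma j)^T = Sigma j.
Proof.
move=> [_ _ [_ _ inc] _ mom] hj; apply/matrixP => k l; rewrite mxE.
have ht : (Tstar j.-1 <= Tstar j.-1 < Tstar j)%N.
  by rewrite leqnn; case: j hj => // j; apply: inc.
have [_ covS] := mom j _ hj ht.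
by apply: EFin_inj; rewrite -!covS covarianceC.
Qed.

End scatter_moments.

(** * Localization with high probability *)

Section estimated_change_points_measurable.
Context d (Omega : measurableType d) (R : realType) (p T : nat).
Variable Th : Omega -> nat -> 'M[R]_p.
Hypothesis mTh : forall t k l, measurable_fun setT (fun w => Th w t k l).

Lemma measurable_mx_eq s t : measurable [set w | Th w s == Th w t].
Proof.
have -> : [set w | Th w s == Th w t] =
    \bigcap_(kl in [set: 'I_p * 'I_p])
      ((fun w => Th w s kl.1 kl.2 - Th w t kl.1 kl.2) @^-1` [set 0]).
  apply/seteqP; split=> w /=.
    by move=> /eqP h kl _ /=; rewrite h subrr.
  move=> h; apply/eqP/matrixP => k l; apply/eqP; rewrite -subr_eq0; apply/eqP.
  exact: (h (k, l)).
apply: fin_bigcap_measurable => // kl _.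
rewrite -[X in measurable X]setTI.
by apply: (measurable_funB (mTh _ _ _) (mTh _ _ _)).
Qed.

(** The list depends on [w] only through the pattern of jumps, which takes finitely many values;
    hence any property [Q] gives a finite union of measurable sets. *)
Lemma measurable_est_cps (Q : seq nat -> Prop) :
  measurable [set w | Q (est_cps T (Th w))].
Proof.
pose jump w := [ffun i : 'I_T.+1 => Th w i != Th w i.-1].
pose sel (f : {ffun 'I_T.+1 -> bool}) := [seq t <- index_iota 2 T.+1 | f (inord t)].
have selE w : est_cps T (Th w) = sel (jump w).
  apply: eq_in_filter => t; rewrite mem_index_iota => /andP[_ tT].
  by rewrite ffunE inordK.
have -> : [set w | Q (est_cps T (Th w))] =
    \bigcup_(f in [set f | Q (sel f)]) [set w | jump w = f].
  apply/seteqP; split=> w /=; rewrite selE; first by exists (jump w).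
  by move=> [f Qf ->].
apply: fin_bigcup_measurable; first exact: finite_finset.
move=> f _.
have -> : [set w | jump w = f] =
    \bigcap_(i in [set: 'I_T.+1]) [set w | (Th w i != Th w i.-1) = f i].
  apply/seteqP; split=> w /=; first by move=> <- i _ /=; rewrite ffunE.
  by move=> h; apply/ffunP => i; rewrite ffunE; exact: h.
apply: fin_bigcap_measurable => // i _.
case: (f i).
  have -> : [set w | (Th w i != Th w i.-1) = true] = ~` [set w | Th w i == Th w i.-1].
    by apply/seteqP; split=> w /= /negP.
  by apply: measurableC; exact: measurable_mx_eq.
have -> : [set w | (Th w i != Th w i.-1) = false] = [set w | Th w i == Th w i.-1].
  by apply/seteqP; split=> w /=; case: eqP.
exact: measurable_mx_eq.
Qed.

End estimated_change_points_measurable.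

Lemma hdist_le (R : realType) (A : seq nat) (m : nat) (Tstar : nat -> nat) (r : R) :
  (forall j, (1 <= j <= m)%N ->
     exists2 t, t \in A & `|t%:R - (Tstar j)%:R| <= r) ->
  (hdist R [set` A] (true_cps m Tstar) <= r%:E)%E.
Proof.
move=> h; apply: ge_ereal_sup => _ [_ [j hj <-] <-].
have [t tA ht] := h j hj.
apply: (@le_trans _ _ (`|t%:R - (Tstar j)%:R|)%:E); last by rewrite lee_fin.
by apply: ereal_inf_lbound; exists t.
Qed.

Section markov.
Context d (Omega : measurableType d) (R : realType) (P : probability Omega R).

(** Stated without dividing by [c], which may vanish: in the application it is a multiple of
    [s ^ 2]. *)
Lemma markov_mul (Z : Omega -> R) (c v : R) :
  P.-integrable setT (EFin \o Z) -> (forall w, 0 <= Z w) -> 0 <= c -> 0 < v ->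
  (P [set w | (v < c * Z w)%R] <= (c * Rintegral P setT Z / v)%:E)%E.
Proof.
move=> iZ Z0 c0 v0.
have iZ' := integrable_scale (c / v) iZ.
have mA : measurable [set w | (v < c * Z w)%R].
  exact: measurable_strict_superlevel (integrable_mfun (integrable_scale c iZ)).
rewrite -[leLHS]fineK ?fin_num_measure // lee_fin -(Rintegral_bool P) //.
rewrite mulrAC -(RintegralZl _ measurableT iZ).
apply: Rintegral_le => //; first exact: sqint_L1 (sqint_bool P mA).
move=> w; case: ltP => [vZ|_] /=; last by rewrite !mulr_ge0 ?invr_ge0 // ltW.
by rewrite mulrAC ler_pdivlMr // mul1r ltW.
Qed.

End markov.

Section located.
Context (R : realType) (d : measure_display) (Omega : measurableType d)
  (P : probability Omega R) (p : nat) (X : int -> Omega -> 'cV[R]_p)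
  (T m : nat) (Tstar : nat -> nat) (Sigma : nat -> 'M[R]_p).
Hypothesis model : change_point_model P X T m Tstar Sigma.

Let Tstar_mono i j : (i <= j <= m.+1)%N -> (Tstar i <= Tstar j)%N.
Proof.
case: model => _ _ [_ _ inc] _ _; elim: j => [|j IH].
  by rewrite leqn0 => /andP[/eqP ->].
rewrite leq_eqVlt => /andP[/predU1P[->//|ij] jm].
apply: leq_trans (ltnW (inc _ jm)); apply: IH.
by rewrite (ltnW jm) andbT -ltnS.
Qed.

Let Tstar_ge1 j : (j <= m.+1)%N -> (1 <= Tstar j)%N.
Proof.
case: model => _ _ [T0 _ _] _ _ jm.
by have := @Tstar_mono 0 j jm; rewrite T0.
Qed.

Let Tstar_leT j : (j <= m.+1)%N -> (Tstar j <= T.+1)%N.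
Proof.
case: model => _ _ [_ TT _] _ _ jm.
by rewrite -TT; apply: Tstar_mono; rewrite jm leqnn.
Qed.

(** On [E], either every change point is located or the noise violates one of the two thresholds of
    [change_point_located]; the last two terms bound these violations. *)
Lemma located_probability (K dl mu s eta l1 l2 : R)
    (Th : Omega -> nat -> 'M[R]_p) (E S : set Omega) (N := (Num.truncn (T%:R * dl)).+1) :
  0 <= K -> 0 < dl -> 0 < mu -> 0 <= s -> 0 < eta -> 0 <= l1 -> 0 <= l2 ->
  (forall j a, (1 <= j <= m.+1)%N -> (1 <= a)%N -> (Tstar j.-1 <= a)%N ->
     (a + N <= Tstar j)%N ->
     let Z w := mxdot (scatter (fun t => X t%:Z w) (Sigma j) a N)
                      (scatter (fun t => X t%:Z w) (Sigma j) a N) in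
     P.-integrable setT (EFin \o Z) /\
     Rintegral P setT Z <= K * p%:R ^+ 2 * N%:R) ->
  (forall j, (1 <= j <= m.+1)%N -> (N <= Tstar j - Tstar j.-1)%N) ->
  (forall j, (1 <= j <= m)%N -> eta <= frob (prec Sigma j.+1 - prec Sigma j)) ->
  (forall j, (1 <= j <= m.+1)%N -> frob (prec Sigma j) <= s) ->
  (forall j, (1 <= j <= m.+1)%N -> mu <= lambda_min (Sigma j)) ->
  l1 * T%:R * p%:R * 64 <= mu * eta -> l2 * 64 <= dl * mu * eta ->
  measurable E -> measurable S ->
  (forall w, E w -> is_gfdtl T l1 l2 (fun t => X t%:Z w) (Th w)) ->
  (forall w, (forall j, (1 <= j <= m)%N -> exists2 t, t \in est_cps T (Th w) &
      `|t%:R - (Tstar j)%:R| <= T%:R * dl) -> S w) ->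
  (P E <= P S + (4 * (m%:R * (2 * (K * p%:R ^+ 2 * N%:R))) / (N%:R * mu) ^+ 2
     + s ^+ 2 * 64 ^+ 2 * (m%:R * (2 * (K * p%:R ^+ 2 * N%:R)))
         / (N%:R * mu * eta) ^+ 2)%:E)%E.
Proof.
move=> K0 dl0 mu0 s0 eta0 l10 l20 moment block jump smax lmin h1 h2 mE mS estE locS.
have N0 : (0 : R) < N%:R by rewrite ltr0n.
have Tdl0 : 0 <= T%:R * dl by rewrite mulr_ge0 // ltW.
have Nitv : T%:R * dl <= N%:R <= T%:R * dl + 1.
  have /andP[lo hi] := truncn_itv Tdl0.
  by rewrite ltW //= /N -natr1 lerD2r.
pose GL j w := scatter (fun t => X t%:Z w) (Sigma j) (Tstar j - N) N.
pose GR j w := scatter (fun t => X t%:Z w) (Sigma j.+1) (Tstar j) N.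
pose Zj j w := mxdot (GL j w) (GL j w) + mxdot (GR j w) (GR j w).
(* [Z] dominates the squared norm of the scatter on each window, so one application of Markov's
   inequality per threshold covers all of them. *)
pose Z w := \sum_(1 <= j < m.+1) Zj j w.
have Zj0 j w : 0 <= Zj j w by rewrite addr_ge0 // mxdot_ge0.
have geom j : (1 <= j <= m)%N -> [/\ (Tstar j.-1 <= Tstar j - N)%N,
    (Tstar j - N + N = Tstar j)%N, (N < Tstar j)%N,
    (Tstar j + N <= Tstar j.+1)%N & (1 <= Tstar j - N)%N].
  move=> hj; have hj1 : (1 <= j <= m.+1)%N by case/andP: hj => -> /leqW ->.
  have hj2 : (1 <= j.+1 <= m.+1)%N by case/andP: hj.
  have b1 := block _ hj1; have b2 := block _ hj2.
  have t1 : (1 <= Tstar j.-1)%N by apply: Tstar_ge1; case/andP: hj1 => _; exact: leq_trans (leq_pred _).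
  have t2 : (Tstar j <= Tstar j.+1)%N by apply: Tstar_mono; rewrite leqnSn; case/andP: hj.
  have t3 : (Tstar j.-1 <= Tstar j)%N by apply: Tstar_mono; rewrite leq_pred; case/andP: hj1.
  clear -b1 b2 t1 t2 t3; move: b1 b2 t1 t2 t3; rewrite /=.
  move: (Tstar j) (Tstar j.-1) (Tstar j.+1) N => x y z n.
  by move=> *; split; lia.
have Zint j : (1 <= j <= m)%N -> P.-integrable setT (EFin \o Zj j) /\
    Rintegral P setT (Zj j) <= 2 * (K * p%:R ^+ 2 * N%:R).
  move=> hj; have [g1 g2 g3 g4 g5] := geom j hj.
  have hj1 : (1 <= j <= m.+1)%N by case/andP: hj => -> /leqW ->.
  have hj2 : (1 <= j.+1 <= m.+1)%N by case/andP: hj.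
  have c1 : (1 <= Tstar j)%N by apply: Tstar_ge1; case/andP: hj1.
  have [iL eL] := moment j _ hj1 g5 g1 (eq_leq g2).
  have [iR eR] := moment j.+1 _ hj2 c1 (leqnn _) g4.
  split; first exact: integrable_add iL iR.
  by rewrite (RintegralD measurableT iL iR) mulr_natl mulr2n lerD.
have [iZ eZ] : P.-integrable setT (EFin \o Z) /\
    Rintegral P setT Z <= m%:R * (2 * (K * p%:R ^+ 2 * N%:R)).
  suff partial : forall n, (n <= m)%N ->
    P.-integrable setT (EFin \o (fun w => \sum_(1 <= j < n.+1) Zj j w)) /\
    Rintegral P setT (fun w => \sum_(1 <= j < n.+1) Zj j w)
      <= n%:R * (2 * (K * p%:R ^+ 2 * N%:R)) by exact: partial.
  elim=> [_|n IH nm].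
    split; first by under eq_fun do rewrite big_geq //; exact: integrable_const.
    under eq_Rintegral do rewrite big_geq //.
    by rewrite Rintegral_prob_cst mul0r.
  have [IH1 IH2] := IH (ltnW nm); have [i1 e1] := Zint n.+1 nm.
  split; first by under eq_fun do rewrite big_nat_recr //=; exact: integrable_add.
  under eq_Rintegral do rewrite big_nat_recr //=.
  by rewrite (RintegralD measurableT IH1 i1) -natr1 mulrDl mul1r lerD.
have Z0 w : 0 <= Z w by apply: sumr_ge0.
have Nmu0 : 0 < N%:R * mu by rewrite mulr_gt0.
have Nmueta0 : 0 < N%:R * mu * eta by rewrite mulr_gt0.
(* The squared thresholds [G * 2 <= N mu] and [s * G * 64 <= N mu eta], with [G ^ 2] replaced by
   [Z]. *)
pose B1 := [set w | ((N%:R * mu) ^+ 2 < 4 * Z w)%R].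
pose B2 := [set w | ((N%:R * mu * eta) ^+ 2 < s ^+ 2 * 64 ^+ 2 * Z w)%R].
have mB (c v : R) : measurable [set w | (v < c * Z w)%R].
  exact: measurable_strict_superlevel (integrable_mfun (integrable_scale c iZ)).
have c40 : (0 : R) <= 4 by [].
have cs0 : 0 <= s ^+ 2 * 64 ^+ 2 by rewrite mulr_ge0 ?exprn_ge0.
have PB1 := markov_mul iZ Z0 c40 (exprn_gt0 2 Nmu0).
have PB2 := markov_mul iZ Z0 cs0 (exprn_gt0 2 Nmueta0).
have ESB : E `<=` S `|` (B1 `|` B2).
  move=> w Ew; have [good1|bad] := leP (4 * Z w) ((N%:R * mu) ^+ 2); last by right; left.
  have [good2|bad] := leP (s ^+ 2 * 64 ^+ 2 * Z w) ((N%:R * mu * eta) ^+ 2); last by right; right.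
  left; apply: locS => j hj; have [g1 g2 g3 g4 g5] := geom j hj.
  have hj1 : (1 <= j <= m.+1)%N by case/andP: hj => -> /leqW ->.
  have hj2 : (1 <= j.+1 <= m.+1)%N by case/andP: hj.
  have ZjZ : Zj j w <= Z w.
    rewrite /Z (bigD1_seq j) ?iota_uniq ?mem_index_iota //= lerDl.
    exact: sumr_ge0.
  have cNT : (Tstar j + N <= T.+1)%N.
    by apply: (leq_trans g4); apply: Tstar_leT; case/andP: hj2.
  refine (change_point_located (estE w Ew) (ltn0Sn _) g3 cNT Nitv
    (model_sym model hj1) (model_sym model hj2) mu0 (lmin j hj1) (lmin j.+1 hj2)
    l10 l20 (smax j hj1) (smax j.+1 hj2) eta0 (jump j hj) _ h1 h2).
  move=> G hG.
  have G0 : 0 <= G by case: hG => ->; exact: frob_ge0.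
  have GZ : G ^+ 2 <= Z w.
    apply: le_trans ZjZ; rewrite /Zj.
    by case: hG => ->; rewrite sqr_frob ?lerDl ?lerDr mxdot_ge0.
  split.
    rewrite -(@ler_pXn2r _ 2) ?nnegrE ?(ltW Nmu0) ?mulr_ge0 //.
    apply: le_trans good1; rewrite exprMn mulrC -natrX ler_wpM2l //.
  rewrite -(@ler_pXn2r _ 2) ?nnegrE ?(ltW Nmueta0) ?mulr_ge0 //.
  apply: le_trans good2; rewrite !exprMn mulrAC ler_wpM2l //.
apply: (@le_trans _ _ (P (S `|` (B1 `|` B2)))).
  apply: le_measure => //; rewrite inE //; apply: measurableU => //.
  by apply: measurableU; exact: mB.
apply: (le_trans (measureU2 _ _ _)) => //; first by apply: measurableU; exact: mB.
rewrite leeD2l // EFinD.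
apply: (le_trans (measureU2 _ _ _)); [exact: mB|exact: mB|].
apply: leeD.
  apply: (le_trans PB1); rewrite lee_fin ler_pM2r ?invr_gt0 ?exprn_gt0 //.
  by rewrite ler_wpM2l.
apply: (le_trans PB2); rewrite lee_fin ler_pM2r ?invr_gt0 ?exprn_gt0 //.
by rewrite ler_wpM2l.
Qed.

End located.

(** * Finite extrema, rates, and conclusion *)

Section finite_extrema.
Variables (R : realType) (m : nat) (f : nat -> R).
Local Notation range_f := [set f j | j in [set j | (1 <= j <= m)%N]].

Lemma inf_range_le j : (forall i, 0 <= f i) -> (1 <= j <= m)%N -> inf range_f <= f j.
Proof.
move=> f0 hj; apply: ge_inf; last by exists j.
by exists 0 => _ [i _ <-].
Qed.

Lemma inf_range_gt0 : (0 < m)%N -> (forall j, (1 <= j <= m)%N -> 0 < f j) ->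
  0 < inf range_f.
Proof.
move=> m0 f0.
have [c c0 hc] : exists2 c : R, 0 < c & forall j, (1 <= j <= m)%N -> c <= f j.
  elim: m f0 => [|n IH] f0; first by exists 1 => // -[|j].
  have [j /andP[j1 jn]|c c0 hc] := IH; first by apply: f0; rewrite j1 leqW.
  exists (Num.min c (f n.+1)); first by rewrite lt_min c0 f0 //= leqnn.
  move=> j /andP[j1]; rewrite leq_eqVlt ltnS => /predU1P[->|jn].
    by rewrite ge_min lexx orbT.
  by rewrite ge_min hc ?j1.
apply: (lt_le_trans c0); apply: lb_le_inf; first by exists (f 1%N), 1%N.
by move=> _ [j hj <-]; exact: hc.
Qed.

Lemma le_sup_range j : (forall i, 0 <= f i) -> (1 <= j <= m)%N -> f j <= sup range_f.
Proof.
move=> f0 hj; apply: ub_le_sup; last by exists j.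
exists (\sum_(1 <= i < m.+1) f i) => _ [i hi <-].
rewrite (bigD1_seq i) ?iota_uniq ?mem_index_iota //= lerDl.
by apply: sumr_ge0.
Qed.

End finite_extrema.

(** If [x >= 1], then [x + 1 <= 2 x <= n]; if [x < 1], the truncation is 0 and a nonempty block
    suffices. *)
Lemma trunc_blocks (R : realType) (x I : R) (n : nat) :
  0 < x -> 2 * x <= I -> I <= n%:R -> (0 < n)%N -> ((Num.truncn x).+1 <= n)%N.
Proof.
move=> x0 xI In n0; have /andP[lo hi] := truncn_itv (ltW x0).
have [x1|x1] := ltP x 1.
  suff -> : Num.truncn x = 0%N by [].
  by apply/eqP; rewrite -leqn0 truncn_le_nat.
by rewrite -(ler_nat R) -natr1; lra.
Qed.

(** Everything reduces to [m / N <= Cm L / D]. With [L = ln (p T)] and [D = T delta], the right-hand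
    side is a multiple of the square of the sequence in [a3_iii_p]. *)
Lemma scatter_bound_rate (R : realType) (m p K Cm L D N mu : R) :
  0 <= m -> m <= Cm * L -> 0 <= K -> 0 <= L -> 0 < D -> D <= N -> 0 < mu ->
  4 * (m * (2 * (K * p ^+ 2 * N))) / (N * mu) ^+ 2 <=
  8 * K * Cm / mu ^+ 2 * (p * Num.sqrt (L / D)) ^+ 2.
Proof.
move=> m0 mL K0 L0 D0 DN mu0; have N0 : 0 < N by exact: lt_le_trans DN.
rewrite [(p * _) ^+ 2]exprMn sqr_sqrtr ?divr_ge0 ?(ltW D0) //.
have -> : 4 * (m * (2 * (K * p ^+ 2 * N))) / (N * mu) ^+ 2 =
  (8 * K * p ^+ 2 / mu ^+ 2) * (m / N) by field; rewrite !gt_eqF.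
have -> : 8 * K * Cm / mu ^+ 2 * (p ^+ 2 * (L / D)) =
  (8 * K * p ^+ 2 / mu ^+ 2) * ((Cm * L) / D) by field; rewrite !gt_eqF.
apply: ler_wpM2l.
  exact: divr_ge0 (mulr_ge0 (mulr_ge0 (ler0n _ 8) K0) (sqr_ge0 p)) (sqr_ge0 mu).
by apply: ler_pM; rewrite ?invr_ge0 ?(ltW N0) // lef_pV2.
Qed.

(** The same comparison for the second threshold, leading to the square of the sequence in
    [a3_iii_s]. *)
Lemma scatter_bound_jump_rate (R : realType) (m p K Cm L D N mu s eta : R) :
  0 <= m -> m <= Cm * L -> 0 <= K -> 0 <= L -> 0 < D -> D <= N -> 0 < mu ->
  0 < eta ->
  s ^+ 2 * 64 ^+ 2 * (m * (2 * (K * p ^+ 2 * N))) / (N * mu * eta) ^+ 2 <=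
  2 * 64 ^+ 2 * K * Cm / mu ^+ 2 *
    ((Num.sqrt D * eta)^-1 * p * s * Num.sqrt L) ^+ 2.
Proof.
move=> m0 mL K0 L0 D0 DN mu0 eta0; have N0 : 0 < N by exact: lt_le_trans DN.
have sD : Num.sqrt D != 0 by rewrite gt_eqF // sqrtr_gt0.
have -> : ((Num.sqrt D * eta)^-1 * p * s * Num.sqrt L) ^+ 2 =
   p ^+ 2 * s ^+ 2 * L / (D * eta ^+ 2).
  by rewrite -{2}(sqr_sqrtr (ltW D0)) -{2}(sqr_sqrtr L0); field; rewrite sD gt_eqF.
have -> : s ^+ 2 * 64 ^+ 2 * (m * (2 * (K * p ^+ 2 * N))) / (N * mu * eta) ^+ 2 =
  (2 * 64 ^+ 2 * K * p ^+ 2 * s ^+ 2 / (mu * eta) ^+ 2) * (m / N).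
  by field; rewrite !gt_eqF.
have -> : 2 * 64 ^+ 2 * K * Cm / mu ^+ 2 * (p ^+ 2 * s ^+ 2 * L / (D * eta ^+ 2)) =
  (2 * 64 ^+ 2 * K * p ^+ 2 * s ^+ 2 / (mu * eta) ^+ 2) * ((Cm * L) / D).
  by field; rewrite !gt_eqF.
apply: ler_wpM2l.
  exact: divr_ge0 (mulr_ge0 (mulr_ge0 (mulr_ge0 (mulr_ge0 (ler0n _ 2)
    (sqr_ge0 64)) K0) (sqr_ge0 p)) (sqr_ge0 s)) (sqr_ge0 (mu * eta)).
by apply: ler_pM; rewrite ?invr_ge0 ?(ltW N0) // lef_pV2.
Qed.

Theorem theorem3p2 (R : realType) (d : measure_display)
  (Omega : measurableType d) (P : probability Omega R)
  (p m mmax : nat -> nat)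
  (X : forall T : nat, int -> Omega -> 'cV[R]_(p T))
  (Tstar : nat -> nat -> nat)
  (Sigma : forall T : nat, nat -> 'M[R]_(p T))
  (calpha rho gamma b mu_lo mu_hi : R)
  (delta lambda1 lambda2 : nat -> R)
  (Thetahat : forall T : nat, Omega -> nat -> 'M[R]_(p T))
  (model : forall T, (0 < T)%N ->
     change_point_model P (X T) T (m T) (Tstar T) (Sigma T))
  (m_le_mmax : forall T, (0 < T)%N -> (m T <= mmax T)%N)
  (mmax_log : exists2 C : R, 0 < C &
     \forall T \near \oo, (mmax T)%:R <= C * ln (T%:R))
  (calpha_gt0 : 0 < calpha) (rho_gt0 : 0 < rho) (rho_lt1 : rho < 1)
  (gamma_gt0 : 0 < gamma) (b_gt0 : 0 < b)
  (A1 : forall T, (0 < T)%N -> assumption1 P (X T) calpha rho gamma b)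
  (mu_lo_gt0 : 0 < mu_lo)
  (A2 : forall T, (0 < T)%N -> assumption2 (m T) (Sigma T) mu_lo mu_hi)
  (A3 : assumption3 m Tstar Sigma gamma delta lambda1 lambda2)
  (lambda1_ge0 : forall T, 0 <= lambda1 T)
  (lambda2_ge0 : forall T, 0 <= lambda2 T)
  (Thetahat_measurable : forall T t k l,
     measurable_fun setT (fun w => Thetahat T w t k l))
  (Thetahat_gfdtl : whp P (fun T => [set w |
     is_gfdtl T (lambda1 T) (lambda2 T) (fun t => X T t%:Z w) (Thetahat T w)]))
  (mhat_bounds : P [set w |
     (m T <= size (est_cps T (Thetahat T w)) <= mmax T)%N]
       @[T --> \oo] --> 1%E) :
  P [set w | (hdist R [set` est_cps T (Thetahat T w)]
                (true_cps (m T) (Tstar T)) <= (T%:R * delta T)%:E)%E]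
    @[T --> \oo] --> 1%E.
Proof.
have [K K0 moment] := scatter_second_moment calpha_gt0 rho_gt0 rho_lt1 gamma_gt0 b_gt0.
case: mmax_log => Cm Cm0 mmax_le.
case: Thetahat_gfdtl => E [mE E_est PE].
pose S T := [set w | (hdist R [set` est_cps T (Thetahat T w)]
                (true_cps (m T) (Tstar T)) <= (T%:R * delta T)%:E)%E].
have mS T : measurable (S T).
  exact: (@measurable_est_cps _ _ _ _ T _ (Thetahat_measurable T)
    (fun s : seq nat => (hdist R [set` s] (true_cps (m T) (Tstar T))
       <= (T%:R * delta T)%:E)%E)).
rewrite -/(S _).
pose rate1 T : R := (p T)%:R * Num.sqrt (ln ((p T * T)%:R) / (T%:R * delta T)).
pose rate2 T : R := (Num.sqrt (T%:R * delta T) * eta_min (m T) (Sigma T))^-1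
  * (p T)%:R * s_max (m T) (Sigma T) * Num.sqrt (ln ((p T * T)%:R)).
pose beta T : R := 8 * K * Cm / mu_lo ^+ 2 * rate1 T ^+ 2 +
  2 * 64 ^+ 2 * K * Cm / mu_lo ^+ 2 * rate2 T ^+ 2.
have beta_cvg : beta T @[T --> \oo] --> (0 : R).
  have sqr_cvg (r : nat -> R) (c : R) : r T @[T --> \oo] --> (0 : R) ->
      c * r T ^+ 2 @[T --> \oo] --> (0 : R).
    move=> hr; have : c * (r T * r T) @[T --> \oo] --> c * (0 * 0).
      by apply: cvgM; [exact: cvg_cst|exact: cvgM].
    by rewrite !mulr0.
  rewrite -[X in _ --> X]addr0; apply: cvgD; apply: sqr_cvg.
    exact: (a3_iii_p A3).
  exact: (a3_iii_s A3).
(* The tolerance that yields the two conditions with factor 64 on [lambda1] and [lambda2]; the 2 for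
   [near_I] is the one of [trunc_blocks]. *)
have mu64 : 0 < mu_lo / 64 by rewrite divr_gt0.
have near_l2 := cvgr0_norm_lt _ (a3_iv_2 A3) _ mu64.
have near_l1 := cvgr0_norm_lt _ (a3_iv_1 A3) _ mu64.
have near_I := cvgry_ge (a3_ii_I A3) 2.
have lower : \forall T \near \oo, (P (E T) - (beta T)%:E <= P (S T))%E.
  near=> T.
  have T0 : (0 < T)%N by near: T; exact: nbhs_infty_gt.
  rewrite leeBlDr //.
  have beta0 : 0 <= beta T.
    by rewrite addr_ge0 // mulr_ge0 ?sqr_ge0 // divr_ge0 ?sqr_ge0 // !mulr_ge0 // ltW.
  (* Without change point [eta_min] is 0 and no window exists, but the distance is a supremum over
     the empty set, so the event is certain. *)
  have [m0|m_gt0] := posnP (m T).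
    have -> : S T = setT.
      apply/seteqP; split=> // w _; apply: hdist_le => j.
      by rewrite m0; case: j.
    by rewrite probability_setT (le_trans (probability_le1 _ (mE T))) // leeDl.
  have modelT := model T T0; have [p0 _ [_ _ inc] prec_neq _] := modelT.
  have dl0 := delta_gt0 A3 T0.
  have D0 : 0 < T%:R * delta T by rewrite mulr_gt0 // ltr0n.
  set eta := eta_min (m T) (Sigma T); set s := s_max (m T) (Sigma T).
  have eta0 : 0 < eta.
    by apply: inf_range_gt0 => // j hj; rewrite frob_gt0 // subr_eq0 prec_neq.
  have s_ge j : (1 <= j <= (m T).+1)%N -> frob (prec (Sigma T) j) <= s.
    by apply: (le_sup_range (f := fun j => frob (prec (Sigma T) j))) => i; exact: frob_ge0.
  have s0 : 0 <= s by apply: le_trans (s_ge 1%N isT); exact: frob_ge0.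
  (* The number of change points is controlled by [ln T] while the rates contain [ln (p T)]; [0 < p]
     bridges the two. *)
  have L0 : ln (T%:R : R) <= ln ((p T * T)%:R).
    by rewrite ler_ln ?posrE ?ltr0n ?muln_gt0 ?p0 // ler_nat leq_pmull.
  have lnT0 : 0 <= ln (T%:R : R) by rewrite ln_ge0 // ler1n.
  have L_ge0 := le_trans lnT0 L0.
  have mL : (m T)%:R <= Cm * ln ((p T * T)%:R) :> R.
    apply: (@le_trans _ _ (mmax T)%:R); first by rewrite ler_nat m_le_mmax.
    apply: (@le_trans _ _ (Cm * ln T%:R)); last by rewrite ler_pM2l.
    by near: T.
  have h2 : lambda2 T * 64 <= delta T * mu_lo * eta.
    have : `|lambda2 T / (eta * delta T)| < mu_lo / 64 by rewrite /eta; near: T; exact: near_l2.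
    move=> /(le_lt_trans (ler_norm _)) /ltW.
    rewrite ler_pdivrMr ?mulr_gt0 // mulrAC ler_pdivlMr // => h.
    by rewrite (le_trans h) // le_eqVlt; apply/orP; left; apply/eqP; ring.
  have h1 : lambda1 T * T%:R * (p T)%:R * 64 <= mu_lo * eta.
    have : `|lambda1 T * T%:R * (p T)%:R / eta| < mu_lo / 64 by rewrite /eta; near: T; exact: near_l1.
    move=> /(le_lt_trans (ler_norm _)) /ltW.
    by rewrite ler_pdivrMr // [mu_lo / 64 * _]mulrAC ler_pdivlMr.
  have Imin : 2 * (T%:R * delta T) <= I_min R (m T) (Tstar T).
    rewrite -ler_pdivlMr //; near: T.
    exact: near_I.
  have block j : (1 <= j <= (m T).+1)%N ->
      ((Num.truncn (T%:R * delta T)).+1 <= Tstar T j - Tstar T j.-1)%N.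
    move=> hj; apply: (trunc_blocks D0 Imin).
      by apply: (inf_range_le (f := fun j => (Tstar T j - Tstar T j.-1)%:R)).
    by rewrite subn_gt0; case: j hj => // j; exact: inc.
  apply: (le_trans (located_probability modelT (K := K) (mu := mu_lo) (s := s)
    (eta := eta) (l1 := lambda1 T) (l2 := lambda2 T) (Th := Thetahat T)
    (E := E T) (S := S T) _ dl0 _ s0 eta0 _ _ _ _ _ _ _ h1 h2 _ _ _ _)) => //.
  - exact: ltW.
  - by move=> j a hj a1 ja aj; exact: moment modelT (A1 T T0) hj a1 ja aj.
  - move=> j hj.
    by apply: (inf_range_le (f := fun j => frob (prec (Sigma T) j.+1 - prec (Sigma T) j))) => // i; exact: frob_ge0.
  - by move=> j hj; case: (A2 T T0 j hj).
  - exact: E_est.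
  - by move=> w; exact: hdist_le.
  rewrite leeD2l // lee_fin; apply: lerD.
    by apply: scatter_bound_rate => //; [exact: ltW|exact: ltW (truncnS_gt _)].
  by apply: scatter_bound_jump_rate => //; [exact: ltW|exact: ltW (truncnS_gt _)].
(* [P (S T)] is squeezed between [P (E T) - beta T] and 1. *)
apply: (@squeeze_cvge _ _ _ _ (fun T => P (E T) - (beta T)%:E)%E _ (fun=> 1%E)).
- near=> T; apply/andP; split; first by near: T.
  exact: (probability_le1 P (mS T)).
- rewrite -[X in _ --> X]sube0; apply: cvgeB => //.
  apply: cvg_EFin; first exact: nearW.
  exact: beta_cvg.
- exact: cvg_cst.
Unshelve. all: by end_near.
Qed.
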